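(* Let $X\subset\mathbb{R}$ be either a finite set or a compact interval $[\underline x,\bar x]$, let $\Delta(X)$ be the set of Borel probability measures on $X$ with the weak$^*$ topology, and let $\Theta=[\underline\theta,\bar\theta]$. Let $u:\mathbb{R}\to\mathbb{R}$ be strictly increasing, continuous and weakly concave. Let $C:\Theta\times\Delta(X)\to\mathbb{R}$ be bounded, with $C(\theta,\cdot)$ weak$^*$-continuous and convex for every $\theta$, and satisfying: (i) for every $\theta$, if $\mu'$ first-order stochastically dominates $\mu$ then $C(\theta,\mu')\ge C(\theta,\mu)$; (ii) for every $(\theta,\mu)$ there is a continuous $c_\mu(\theta,\cdot):X\to\mathbb{R}$ with $\lim_{\varepsilon\searrow0}\big(C(\theta,(1-\varepsilon)\mu+\varepsilon\mu')-C(\theta,\mu)\big)/\varepsilon=\int_X c_\mu(\theta,x)\,[\mu'-\mu](\mathrm{d}x)$ for all $\mu'\in\Delta(X)$; (iii) for every $\mu$, $C(\cdot,\mu)$ is strictly decreasing and continuously differentiable, and for every $\theta$, $\sup_{\mu\in\Delta(X)}|\partial C(\theta,\mu)/\partial\theta|<\infty$. For a wage $w:X\to\mathbb{R}$ define $U(\theta,w,\mu)=\int_X u(w(x))\,\mu(\mathrm{d}x)-C(\theta,\mu)$. Let $\{w_\theta,\mu_\theta\}_{\theta\in\Theta}$ be a mechanism in which each $w_\theta:X\to\mathbb{R}$ is measurable, bounded above, non-decreasing and right-continuous, and each $\mu_\theta\in\Delta(X)$. Call it incentive compatible if $U(\theta,w_\theta,\mu_\theta)\ge U(\theta,w_{\hat\theta},\mu')$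 for all $\theta,\hat\theta\in\Theta$ and all $\mu'\in\Delta(X)$. Then the mechanism is incentive compatible if and only if there exist a family $\{\mu_{\theta,\hat\theta}\}_{(\theta,\hat\theta)\in\Theta^2}\subset\Delta(X)$ with $\mu_{\theta,\theta}=\mu_\theta$ for all $\theta$, and an absolutely continuous function $V:\Theta\to\mathbb{R}$ with $V(\theta)=U(\theta,w_\theta,\mu_\theta)$ for all $\theta$, such that for all $\theta\in\Theta$: 1. (Envelope) $V(\theta)=V(\underline\theta)-\int_{\underline\theta}^{\theta}\frac{\partial C}{\partial\theta}(t,\mu_t)\,\mathrm{d}t$; 2. (Generalized monotonicity) $\int_{\hat\theta}^{\theta}\Big[-\frac{\partial C}{\partial\theta}(t,\mu_t)+\frac{\partial C}{\partial\theta}(t,\mu_{t,\hat\theta})\Big]\mathrm{d}t\ge0$ for all $\hat\theta\in\Theta$; 3. (On-path obedience) $w_\theta(x)\le u^{-1}\Big(c_{\mu_\theta}(\theta,x)+V(\theta)+C(\theta,\mu_\theta)-\int_X c_{\mu_\theta}(\theta,y)\,\mu_\theta(\mathrm{d}y)\Big)$ for all $x\in X$, with equality for $\mu_\theta$-almost all $x\in X$; 4. (Off-path obedience) $\mu_{\theta,\hat\theta}\in\arg\max_{\nu\in\Delta(X)}\int_X\big[u(w_{\hat\theta}(x))-c_{\mu_{\theta,\hat\theta}}(\theta,x)\big]\,\nu(\mathrm{d}x)$ for all $\hat\theta\neq\theta$.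
   Context: Here $\partial C(t,\mu)/\partial\theta$ denotes the derivative of $C$ with respect to its first (type) argument evaluated at $t$. The family $\{\mu_{\theta,\hat\theta}\}$ (a ''generalized recommendation schedule'') is interpreted as the output distribution recommended to an agent of true type $\theta$ who reports $\hat\theta$ and thus receives contract $w_{\hat\theta}$. $u^{-1}$ is the inverse of the strictly increasing function $u$. *)

(* Defs.v *)
From mathcomp Require Import all_boot all_order all_algebra.
From mathcomp Require Import all_classical all_reals all_analysis.
Set Implicit Arguments. Unset Strict Implicit. Unset Printing Implicit Defensive.
Import Order.TTheory GRing.Theory Num.Theory numFieldNormedType.Exports.
Local Open Scope classical_set_scope.
Local Open Scope ring_scope.

Section Defs.
Variable R : realType.

Definition inDelta (X : set R) (mu : probability R R) : Prop := mu X = 1%E.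

Definition peq (mu nu : probability R R) : Prop :=
  forall A : set R, measurable A -> mu A = nu A.

Definition is_mixture (nu mu mu' : probability R R) (e : R) : Prop :=
  forall A : set R, measurable A -> nu A = ((1 - e)%:E * mu A + e%:E * mu' A)%E.

Definition fosd (mu' mu : probability R R) : Prop :=
  forall t : R, (mu' `]-oo, t]%classic <= mu `]-oo, t]%classic)%E.

(* weak* convergence of a sequence in Delta(X) (X compact metric) *)
Definition weak_cvg (X : set R) (mun : nat -> probability R R) (mu : probability R R) : Prop :=
  forall f : R -> R, {within X, continuous f} ->
    (fun n => \int[mun n]_(x in X) f x) @ \oo --> \int[mu]_(x in X) f x.

Definition has_deriv_on (a b : R) (f f' : R -> R) : Prop :=
  forall t, a <= t <= b ->
    (fun h => (f (t + h) - f t) / h) @ within (fun h => a <= t + h <= b) ((0:R)^')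
      --> f' t.

Definition C1_on (a b : R) (f f' : R -> R) : Prop :=
  has_deriv_on a b f f' /\ {within `[a, b]%classic, continuous f'}.

Definition abs_cont_on (a b : R) (f : R -> R) : Prop :=
  forall e : R, 0 < e -> exists2 d : R, 0 < d &
    forall (n : nat) (s t : nat -> R),
      (forall i, (i < n)%N -> a <= s i /\ s i <= t i /\ t i <= b) ->
      (forall i j, (i < j < n)%N -> t i <= s j) ->
      \sum_(i < n) (t i - s i) < d ->
      \sum_(i < n) `|f (t i) - f (s i)| < e.

(* Lebesgue integral (w.r.t. the completed Lebesgue measure) of f over [a,b]
   equals v: f agrees a.e. on [a,b] with a Borel integrable g, and v = int g *)
Definition LInt (a b : R) (f : R -> R) (v : R) : Prop :=
  exists g : R -> R,
    lebesgue_measure.-integrable `[a, b]%classic (EFin \o g) /\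
    {ae lebesgue_measure, forall t, `[a, b]%classic t -> f t = g t} /\
    v = \int[lebesgue_measure]_(t in `[a, b]%classic) g t.

Definition OInt (a b : R) (f : R -> R) (v : R) : Prop :=
  if a <= b then LInt a b f v else LInt b a f (- v).

(* generalized inverse of u: sup {x | u x <= z} in the extended reals;
   equals the usual inverse u^{-1}(z) when z is in the range of u *)
Definition uinv (u : R -> R) (z : R) : \bar R :=
  ereal_sup [set x%:E | x in [set x : R | u x <= z]].

Definition Upay (X : set R) (u : R -> R) (C : R -> probability R R -> R)
  (th : R) (w : R -> R) (mu : probability R R) : R :=
  \int[mu]_(x in X) u (w x) - C th mu.

End Defs.

(* Main.v *)
(** A report [th'] turns the problem of the agent of type [t] into the
    maximization of [int u(w_th') dm - C(t, m)] over [m] in [Delta(X)].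
    Convexity and the directional derivative of [C] make the obedience conditions
    the first-order conditions of this concave problem, and its solutions exist
    because [Delta(X)] is weak*-sequentially compact (Helly's theorem for quantile
    functions) and the objective is upper semicontinuous.

    The value [V(t) = a(t) - C(t, m_t)] of any such family of optimal choices obeys
    the envelope formula although [dC] has no integrable majorant.  Comparing
    types [s <= t] at the choice [m_t] gives [V t - V s <= C(s, m_t) - C(t, m_t)],
    hence finite upper left derivates everywhere; and [V] is continuous, by a Dini
    argument over [Delta(X)].  The Stieltjes measure of [V] is thus dominated by a
    multiple of the Lebesgue measure on each piece of a countable cover, so [V] is
    the integral of a density (Radon-Nikodym), which equals [V'(t) = - dC(t, m_t)]
    almost everywhere.

    Incentive compatibility says that [V] dominates the value [W_th'] of reporting
    [th'].  The two agree at [th'], so by the envelope formulas the inequality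
    [W_th' <= V] is generalized monotonicity. *)

From HB Require Import structures.
Require Import Defs.
From mathcomp Require Import all_boot all_order all_algebra.
From mathcomp Require Import all_classical all_reals all_analysis.
From mathcomp Require Import measurable_realfun ring lra.
Import Order.TTheory GRing.Theory Num.Theory numFieldNormedType.Exports.
Local Open Scope classical_set_scope.
Local Open Scope ring_scope.
Set Implicit Arguments. Unset Strict Implicit. Unset Printing Implicit Defensive.

(** * Absolutely continuous Stieltjes measures *)

Section Stieltjes_abs_cont.
Context {R : realType}.
Notation lambda := (@lebesgue_measure R).

(** A Lebesgue-null set has countable covers by half-open intervals of arbitrarily small total
    length, and [m] of each interval is controlled by its length. Dividing by [k + 1] stays
    legitimate when [k = 0]. *)
Lemma measure_null_of_lipschitz (m : {measure set (measurableTypeR R) -> \bar R}) (k : R) :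
  0 <= k ->
  (forall a b : R, a <= b -> (m `]a, b]%classic <= (k * (b - a))%:E)%E) ->
  forall A, measurable A -> lambda A = 0%E -> m A = 0%E.
Proof.
move=> k0 mk A mA A0; apply/eqP; rewrite eq_le measure_ge0 andbT.
apply/lee_addgt0Pr => e e0; rewrite add0e.
have k1 : 0 < k + 1 by lra.
have : (lambda A < (e / (k + 1))%:E)%E by rewrite A0 lte_fin divr_gt0.
rewrite /lebesgue_measure /lebesgue_stieltjes_measure/= /measure_extension.
rewrite /mu_ext => /ereal_inf_lt[_ [J [mJ AJ] <-] Je].
apply: (@le_trans _ _ (\sum_(i <oo) m (J i))%E).
  apply: measure_sigma_subadditive => // i.
  by apply: sub_sigma_algebra; exact: mJ.
apply: (@le_trans _ _ (\sum_(i <oo) ((k+1)%:E * wlength idfun (J i)))%E).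
  apply: lee_nneseries => [i _ _|i _]; first exact: measure_ge0.
  have [[a b] _ /= <-] := mJ i.
  have [ab|ba] := leP a b.
    rewrite wlength_itv_bnd//= -EFinM; apply: (le_trans (mk _ _ ab)).
    by rewrite lee_fin ler_wpM2r//; lra.
  by rewrite set_itv_ge ?measure0 ?wlength0 ?mule0// bnd_simp -leNgt ltW.
rewrite nneseriesZl; last by move=> i _; exact: measure_ge0.
  rewrite -(@mulfK _ (k + 1) _ e) ?gt_eqF// mulrAC [X in (_ <= X)%E]EFinM muleC.
  by rewrite lee_wpmul2r// ?lee_fin ltW.
Qed.


Variable F : cumulativeBounded (0 : R) (1 : R).
Hypothesis cF : continuous F.
Hypothesis lipF : forall t, exists k : R, forall s, s <= t -> F t - F s <= k * (t - s).
Let nu := lebesgue_stieltjes_measure F.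

(* The Stieltjes measure is [k]-Lipschitz on [E k], and the sets [E n] exhaust the line. *)
Let E (k : R) : set R := [set t | forall s, s <= t -> F t - F s <= k * (t - s)].

(** Each requirement [s <= t -> ...] is a union of two closed conditions: [t < s] may be relaxed to
    [t <= s], as both sides of the inequality vanish at [t = s]. *)
Let closed_E k : closed (E k).
Proof.
have -> : E k = \bigcap_(s in [set: R])
    ([set t | t <= s] `|` [set t | F t - F s - k * (t - s) <= 0]).
  apply/seteqP; split => t /= Et s; last first.
    move=> st; case: (Et s I) => /= [ts|]; last lra.
    by rewrite (@le_anti _ _ s t) ?st ?ts// !subrr mulr0.
  move=> _ /=; have [ts|/ltW st] := leP t s; [by left|right].
  by have := Et s st; rewrite /=; lra.
apply: closed_bigI => s _; apply: closedU; first exact: closed_le.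
rewrite (_ : [set t | _] = (fun t => F t - F s - k * (t - s)) @^-1` [set x | x <= 0])//.
apply: preimage_closed; last exact: closed_le.
move=> t _; apply: cvgB; first by apply: cvgB; [exact: cF|exact: cvg_cst].
by apply: cvgMl_tmp; apply: cvgB; [exact: cvg_id|exact: cvg_cst].
Qed.

Lemma stieltjes_itv a b : a <= b -> nu `]a, b]%classic = (F b - F a)%:E.
Proof.
move=> ab; rewrite /nu/= /lebesgue_stieltjes_measure /measure_extension.
by rewrite measurable_mu_extE/= ?wlength_itv_bnd//; exact: is_ocitv.
Qed.

(** A point of [E n%:R] in []a, b]] has [F]-value at most [F a + n (b - a)]. If [F b] exceeds this
    by more than [e], the intermediate value theorem gives a [q] where the excess is exactly [e],
    and [E n%:R] meets []a, b]] only inside []a, q]]. *)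
Let nu_E (n : nat) a b : a <= b -> (nu (E n%:R `&` `]a, b]%classic) <= (n%:R * (b - a))%:E)%E.
Proof.
move=> ab; apply/lee_addgt0Pr => e e0; rewrite -EFinD.
have mE : measurable (E n%:R) by exact: closed_measurable.
have Eab x : E n%:R x -> a < x <= b -> F x <= F a + n%:R * (b - a).
  move=> Ex /andP[ax xb]; have := Ex a (ltW ax).
  have : n%:R * (x - a) <= n%:R * (b - a) by rewrite ler_wpM2l// lerB.
  by lra.
have [Fb|Fb] := leP (F b) (F a + n%:R * (b - a) + e).
  apply: (@le_trans _ _ (nu `]a, b]%classic)).
    by apply: le_measure; rewrite ?inE//; exact: measurableI.
  by rewrite stieltjes_itv// lee_fin; lra.
have nba : 0 <= n%:R * (b - a) by rewrite mulr_ge0// subr_ge0.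
have [||q /[!in_itv]/= /andP[aq qb] Fq] := @IVT _ F a b (F a + n%:R * (b - a) + e) ab.
- exact: continuous_subspaceT.
- by rewrite ge_min le_max (ltW Fb) orbT andbT; apply/orP; left; lra.
apply: (@le_trans _ _ (nu `]a, q]%classic)).
  apply: le_measure; rewrite ?inE//; first exact: measurableI.
  move=> x [Ex]; rewrite /= !in_itv/= => /andP[ax xb]; rewrite ax/=.
  have := Eab x Ex; rewrite ax xb => /(_ isT) Fx.
  have ndF : {homo F : x y / x <= y} := cumulative_is_nondecreasing F.
  by rewrite leNgt; apply/negP => /ltW /ndF; rewrite Fq; lra.
by rewrite stieltjes_itv// lee_fin Fq; lra.
Qed.

(** Restricted to [E n%:R], [nu] is [n]-Lipschitz on intervals, hence vanishes on null sets; [lipF]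
    places every point in some [E n%:R], and countable subadditivity concludes. *)
Lemma stieltjes_abs_cont : nu `<< lambda.
Proof.
apply/null_content_dominatesP => A mA A0.
have mE k : measurable (E k) by exact: closed_measurable.
have nuE0 n : nu (E n%:R `&` A) = 0%E.
  pose m := mrestr nu (mE n%:R).
  suff : m A = 0%E by rewrite /m /mrestr setIC.
  apply: (@measure_null_of_lipschitz m n%:R) => // a b ab.
  by rewrite /m /= /mrestr setIC; exact: nu_E.
have AE : A `<=` \bigcup_n (E n%:R `&` A).
  move=> x Ax; have [k kx] := lipF x; exists (Num.truncn k).+1 => //; split => // s sx.
  by apply: (le_trans (kx s sx)); rewrite ler_wpM2r ?subr_ge0// ltW// truncnS_gt.
apply/eqP; rewrite eq_le measure_ge0 andbT.
apply: (@le_trans _ _ (\sum_(n <oo) nu (E n%:R `&` A))%E).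
  apply: (@measure_sigma_subadditive _ _ _ nu) => // n.
  by apply: measurableI => //; exact: mE.
by rewrite eseries0// => n _ _; exact: nuE0.
Qed.

(** The Radon-Nikodym derivative is finite everywhere, so [fine] makes it real without changing it;
    passing from []a, b]] to [[a, b]] adds a null point. *)
Lemma stieltjes_density : exists g : R -> R,
  [/\ lambda.-integrable setT (EFin \o g) &
     forall a b, a <= b -> F b - F a = \int[lambda]_(t in `[a, b]) g t].
Proof.
pose f := Radon_Nikodym (charge_of_finite_measure nu) lambda.
have nl : charge_of_finite_measure nu `<< lambda by exact: stieltjes_abs_cont.
exists (fine \o f).
have fE : EFin \o (fine \o f) = f.
  by apply/funext => x /=; rewrite fineK//; exact: Radon_Nikodym_fin_num.
split; first by rewrite fE; exact: Radon_Nikodym_integrable.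
move=> a b ab.
have : nu `]a, b]%classic = (\int[lambda]_(x in `]a, b]) f x)%E.
  by rewrite -Radon_Nikodym_integral.
rewrite stieltjes_itv// -fE => /(congr1 fine)/= ->.
rewrite -/(Rintegral lambda _ _) Rintegral_itv_obnd_cbnd//.
by apply: (@integrableS _ _ _ _ setT) => //; rewrite fE; exact: Radon_Nikodym_integrable.
Qed.

End Stieltjes_abs_cont.

(** * Density and almost-everywhere derivative of a monotone value function *)

Section Value_density.
Context {R : realType}.
Notation lambda := (@lebesgue_measure R).

Lemma has_deriv_eps (a b : R) (f f' : R -> R) (t : R) :
  has_deriv_on a b f f' -> a <= t <= b ->
  forall e : R, 0 < e -> exists2 d : R, 0 < d & forall x : R, x != 0 -> `|x| < d ->
    a <= t + x <= b -> `|(f (t + x) - f t) / x - f' t| < e.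
Proof.
move=> df tab e e0; have /cvgrPdist_lt/(_ e e0) := df t tab.
rewrite near_withinE near_withinE => /nbhs_ballP[d /= d0 H].
exists d => // x x0 xd abx; rewrite distrC; apply: H => //.
by rewrite /ball/= sub0r normrN.
Qed.

Variables (l h : R) (V : R -> R).
Hypothesis lh : l < h.
Hypothesis ndV : forall s t : R, l <= s -> s <= t -> t <= h -> V s <= V t.
Hypothesis Vlh : V l < V h.
Hypothesis cV : forall t e : R, l <= t <= h -> 0 < e -> exists2 d : R, 0 < d &
  forall s : R, l <= s <= h -> `|s - t| < d -> `|V s - V t| < e.
Hypothesis lipV : forall t : R, l <= t <= h -> exists k : R, forall s : R, l <= s <= t ->
  V t - V s <= k * (t - s).

Let cl (t : R) := Num.max l (Num.min t h).

Let cl_itv t : l <= cl t <= h.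
Proof. by rewrite /cl le_max lexx/= ge_max (ltW lh) ge_min lexx orbT. Qed.

Let cl_id t : l <= t <= h -> cl t = t.
Proof. by move=> /andP[lt th]; rewrite /cl (min_l th) max_r. Qed.

Let cl_nd s t : s <= t -> cl s <= cl t.
Proof. by move=> st; rewrite /cl; case: (leP s h); case: (leP t h); rewrite ?ge_max ?le_max; lra. Qed.

Let cl_lip s t : `|cl s - cl t| <= `|s - t|.
Proof.
wlog st : s t / s <= t.
  move=> H; have [/H//|/ltW/H] := leP s t; by rewrite distrC (distrC t).
rewrite distrC (distrC s) !ger0_norm ?subr_ge0 ?cl_nd//.
rewrite /cl /Num.max /Num.min; repeat case: ifPn; rewrite -?leNgt; lra.
Qed.

Let dV := V h - V l.
Let dV0 : 0 < dV. Proof. by rewrite subr_gt0. Qed.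
(** [V] extended by constants outside [[l, h]] and rescaled to run from 0 to 1: a bounded cumulative
    function, whose Stieltjes measure is finite. *)
Let F t := (V (cl t) - V l) / dV.

Let F_nd : {homo F : s t / s <= t}.
Proof.
move=> s t st; rewrite /F ler_wpM2r ?invr_ge0 ?(ltW dV0)// lerB// ndV ?cl_nd//.
- by case/andP: (cl_itv s).
- by case/andP: (cl_itv t).
Qed.

Let F_cont : continuous F.
Proof.
move=> t; apply/cvgrPdist_lt => e e0.
have [d d0 H] := cV (cl_itv t) (mulr_gt0 e0 dV0).
apply/nbhs_ballP; exists d => //= s; rewrite /ball/= => ts.
rewrite distrC /F -mulrBl opprB addrA subrK normrM normfV (gtr0_norm dV0).
rewrite ltr_pdivrMr//; apply: H => //.
by apply: le_lt_trans (cl_lip _ _) _; rewrite distrC.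
Qed.

Let F_rc : right_continuous F.
Proof. by move=> t; apply: cvg_at_right_filter; exact: F_cont. Qed.

Let F_Ny : F @ -oo --> (0 : R).
Proof.
apply: cvg_near_cst; near=> t.
have tl : t <= l by near: t; apply: nbhs_ninfty_le; exact: num_real.
by rewrite /F /cl min_l ?max_l// ?subrr ?mul0r//; lra.
Unshelve. all: by end_near. Qed.

Let F_y : F @ +oo --> (1 : R).
Proof.
apply: cvg_near_cst; near=> t.
have ht : h <= t by near: t; apply: nbhs_pinfty_ge; exact: num_real.
by rewrite /F /cl min_r// max_r ?(ltW lh)// divff// gt_eqF.
Unshelve. all: by end_near. Qed.

Let Fc := HB.pack_for (cumulativeBounded (0 : R) (1 : R)) F
  (isCumulative.Build R _ R F F_nd F_rc)
  (isCumulativeBounded.Build R 0 1 F F_Ny F_y).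

(** The density is that of [F] scaled back by [dV]. Lebesgue differentiation of its integral from
    [l] gives the last clause, at interior points, near which the quotients of [V] and of the
    integral coincide. *)
Lemma value_density : exists g : R -> R,
  [/\ lambda.-integrable setT (EFin \o g),
     forall a b : R, l <= a -> a <= b -> b <= h -> V b - V a = \int[lambda]_(t in `[a, b]) g t &
     {ae lambda, forall t : R, l < t < h ->
        (fun x => (V (t + x) - V t) / x) @ (0 : R)^' --> g t}].
Proof.
have lipF t : exists k : R, forall s, s <= t -> F t - F s <= k * (t - s).
  have [k kV] := lipV (cl_itv t).
  (* A nonnegative constant allows the clamped increment [cl t - cl s] to be replaced by the larger
     [t - s]. *)
  exists (Num.max 0 k / dV) => s st.
  rewrite /F -mulrBl opprB addrA subrK mulrAC ler_wpM2r ?invr_ge0 ?(ltW dV0)//.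
  apply: le_trans (kV (cl s) _) _.
    by rewrite cl_nd// andbT; case/andP: (cl_itv s).
  apply: (@le_trans _ _ (Num.max 0 k * (cl t - cl s))).
    by rewrite ler_wpM2r ?subr_ge0 ?cl_nd// le_max lexx orbT.
  rewrite ler_wpM2l ?le_max ?lexx//; have := cl_lip t s.
  by rewrite !ger0_norm ?subr_ge0// cl_nd.
have [g [ig gF]] := @stieltjes_density R Fc F_cont lipF.
have Vg a b : l <= a -> a <= b -> b <= h ->
    V b - V a = \int[lambda]_(t in `[a, b]) (dV * g t).
  move=> la ab bh; rewrite RintegralZl//; last exact: integrableS ig.
  rewrite -gF//= /F !cl_id; [|lra..].
  by rewrite -mulrBl opprB addrA subrK mulrC divfK// gt_eqF.
have idg : lambda.-integrable setT (EFin \o (fun t => dV * g t)).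
  have -> : EFin \o (fun t => dV * g t) = (fun t => dV%:E * (EFin \o g) t)%E by [].
  exact: integrableZl.
exists (fun t => dV * g t); split => //.
have idgy y : lambda.-integrable [set` Interval (BLeft l) (BRight y)]
    (EFin \o (fun t => dV * g t)) by exact: integrableS idg.
have ldg : locally_integrable setT (fun t => dV * g t).
  by have := integrable_locally measurableT idg; rewrite patch_setT.
have /= := FTC1 idgy ldg.
apply: (@filterS _ _ (ae_filter_ringOfSetsType lambda)) => t Ht /andP[lt th].
have [|+ +] := Ht; first by rewrite lte_fin.
move=> /cvg_ex[/= D HD]; rewrite derive1E /derive/=.
have /cvg_lim -> // := HD; move=> DE; rewrite DE in HD.
apply: cvg_trans HD; apply: near_eq_cvg; near=> x.
have x0 : x != 0 by near: x; exact: nbhs_dnbhs_neq.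
have : `|x| < Num.min (t - l) (h - t).
  near: x; apply: dnbhs0_lt; by rewrite lt_min !subr_gt0 lt th.
rewrite lt_min => /andP[]; rewrite !ltr_norml => /andP[x1 x2] /andP[x3 x4].
rewrite /shift/= /GRing.scale/= mulr1 (addrC x) mulrC -!Vg; [|lra..].
by rewrite opprB addrA subrK.
Unshelve. all: by end_near. Qed.

End Value_density.

(** * Weak* sequential compactness of the probabilities on a compact set *)

Section Quantiles.
Context {R : realType}.
Notation lambda := (@lebesgue_measure R).

(** Half-open intervals are stable under intersection, generate the Borel sets, and have as
    probability a difference of two values of the distribution function. *)
Lemma probability_eq_cdf (P1 P2 : probability R R) :
  (forall t, P1 `]-oo, t]%classic = P2 `]-oo, t]%classic) -> peq P1 P2.
Proof.
move=> P12 A mA.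
apply: (@measure_unique _ R R (@ocitv R) (fun k => `](- k%:R), k%:R]%classic) _ _ _ _ P1 P2) => //.
- exact: ocitvI.
- by move=> k; exact: is_ocitv.
- by rewrite -(bigcup_itvT false false).
- move=> _ [[a b] _ /= <-].
  have [ab|ba] := leP a b; last first.
    by rewrite set_itv_ge ?measure0// bnd_simp -leNgt ltW.
  have -> : `]a, b]%classic = `]-oo, b] `\` `]-oo, a] :> set R.
    by rewrite -[RHS]setCK setCD setCitvl setUC -[LHS]setCK setCitv.
  have sab : `]-oo, a] `<=` (`]-oo, b] : set R) by exact: subset_itvl.
  have fin (P : probability R R) t : (P `]-oo, t]%classic < +oo)%E.
    by rewrite -ge0_fin_numE// fin_num_measure.
  rewrite !measureD ?setIidr ?fin//.
  by congr (_ - _)%E; exact: P12.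
- by move=> k; rewrite -ge0_fin_numE// fin_num_measure.
Qed.

Notation U01 := (uniform_prob (@ltr01 R)).

Lemma uniform01E (A : set R) : measurable A -> U01 A = lambda (A `&` `[0, 1]).
Proof.
move=> mA; rewrite /uniform_prob integral_uniform_pdf.
rewrite (eq_integral (cst 1%E)).
  by rewrite integral_cst ?mul1e//; exact: measurableI.
move=> x; rewrite inE => -[_ /=]; rewrite in_itv/= /uniform_pdf => ->.
by rewrite subr0 invr1.
Qed.

Section Quantile.
Variables (P : probability R R) (M : R).
Hypothesis PM : P `[- M, M]%classic = 1%E.

(* The clause [x = M] only matters for [p > 1], where it keeps [S p] nonempty. *)
Let S (p : R) := [set x | - M <= x <= M /\ ((p%:E <= P `]-oo, x]%classic)%E \/ x = M)].

(** The generalized inverse of the distribution function. Confining the infimum to [[- M, M]] makes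
    it bounded and monotone on the whole line, also for [p] outside [[0, 1]]. *)
Definition quantile (p : R) := inf (S p).

Let M0 : - M <= M.
Proof.
rewrite leNgt; apply/negP => MM; move: PM; rewrite set_itv_ge ?bnd_simp -?ltNge//.
by rewrite measure0 => /eqP; rewrite eq_sym onee_eq0.
Qed.

Let SM p : S p M. Proof. by split; [rewrite lexx M0|right]. Qed.

Let hasS p : has_inf (S p).
Proof. by split; [exists M; exact: SM|exists (- M) => x [/andP[]]]. Qed.

Lemma quantile_itv p : - M <= quantile p <= M.
Proof.
apply/andP; split; last exact: (ge_inf (hasS p).2 (SM p)).
by apply: lb_le_inf; [exists M; exact: SM|move=> x [/andP[]]].
Qed.

Lemma quantile_nd : {homo quantile : p p' / p <= p'}.
Proof.
move=> p p' pp'; apply: lb_le_inf; first by exists M; exact: SM.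
move=> x [xM H]; apply: (ge_inf (hasS p).2); split => //.
by case: H => [H|]; [left; apply: le_trans H; rewrite lee_fin|right].
Qed.

Let F x := P `]-oo, x]%classic.

Let F_nd x y : x <= y -> (F x <= F y)%E.
Proof.
by move=> xy; apply: le_measure; rewrite ?inE//; exact: subset_itvl.
Qed.

Let F_rc : right_continuous F.
Proof.
pose idR := HB.pack_for {mfun R >-> R} (@idfun R)
  (isMeasurableFun.Build _ _ R R (@idfun R) (@measurable_id _ _ setT)).
have FE : F = cdf (idR : {RV P >-> R}) by [].
move=> t; rewrite FE; exact: cdf_right_continuous.
Qed.

Let FM t : M <= t -> F t = 1%E.
Proof.
move=> Mt; apply/eqP; rewrite eq_le probability_le1//= -PM.
apply: le_measure; rewrite ?inE// => x /=; rewrite !in_itv/= => /andP[_ xM].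
exact: le_trans xM Mt.
Qed.

Let FN t : t < - M -> F t = 0%E.
Proof.
move=> tM; have := probability_setC P (measurable_itv `[- M, M]); rewrite PM subee// => C0.
apply/eqP; rewrite eq_le measure_ge0 andbT -C0.
apply: le_measure; rewrite ?inE//; first exact: measurableC.
by move=> x /=; rewrite !in_itv/= => xt; apply/negP; lra.
Qed.

(** Right continuity of [F] makes the infimum attained. The bounds on [p] settle the extremes:
    [p > F t = 0] for [t < - M], and [p <= F t = 1] for [t >= M]. *)
Lemma quantile_le p t : 0 < p <= 1 -> (quantile p <= t) = (p%:E <= F t)%E.
Proof.
move=> /andP[p0 p1]; have /andP[q1 q2] := quantile_itv p.
have [Mt|tM] := leP M t; first by rewrite FM// lee_fin p1 (le_trans q2).
have [Mt|tM'] := leP (- M) t; last first.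
  rewrite FN// lee_fin; apply/idP/idP; lra.
apply/idP/idP => [qt|pF]; last first.
  by apply: (ge_inf (hasS p).2); split; [rewrite Mt ltW|left].
(* Any [y > t] lies above some element of [S p], so [F y >= p]; then [y] decreases to [t]. *)
suff H : \forall y \near t^'+, (p%:E <= F y)%E.
  have := closed_cvg (fun x : \bar R => (p%:E <= x)%E) _ H; apply; last exact: F_rc.
  exact: closed_ereal_le_ereal.
near=> y.
have ty : t < y by near: y; exact: nbhs_right_gt.
have [|x [xM Sx]] := @inf_adherent _ (S p) (y - t) _ (hasS p); first lra.
rewrite -/(quantile p) => xq.
have xy : x <= y by lra.
case: Sx => [H|xE]; first exact: le_trans H (F_nd xy).
by rewrite FM ?lee_fin//; rewrite -xE.
Unshelve. all: by end_near. Qed.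

Lemma measurable_quantile : measurable_fun setT quantile.
Proof. by apply: nondecreasing_measurable => //; exact: quantile_nd. Qed.

End Quantile.

Definition mfun_of (q : R -> R) (mq : measurable_fun setT q) : {mfun (measurableTypeR R) >-> R} :=
  HB.pack_for {mfun (measurableTypeR R) >-> R} q
    (isMeasurableFun.Build _ _ (measurableTypeR R) R q mq).

Definition law (q : R -> R) (mq : measurable_fun setT q) : probability R R :=
  distribution U01 (mfun_of mq).

Lemma lawE (q : R -> R) (mq : measurable_fun setT q) A : law mq A = U01 (q @^-1` A).
Proof. by []. Qed.

(** The quantile transform: by [quantile_le], the [p] in []0, 1]] with quantile at most [t] form an
    interval whose length is the mass of []-oo, t]]. The point 0 is left undecided, whence separate
    bounds by a closed and a half-open interval. *)
Lemma law_quantile (P : probability R R) (M : R) (PM : P `[- M, M]%classic = 1%E) :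
  peq (law (measurable_quantile PM)) P.
Proof.
apply: probability_eq_cdf => t.
have mQ : measurable (quantile P M @^-1` `]-oo, t]).
  by rewrite -[X in measurable X]setTI; exact: (measurable_quantile PM).
rewrite lawE uniform01E; last exact: mQ.
set F := P _.
have Ffin : F \is a fin_num by rewrite fin_num_measure.
have F0 : 0 <= fine F by apply: fine_ge0; exact: measure_ge0.
have F1 : fine F <= 1 by rewrite -lee_fin fineK//; exact: probability_le1.
have QF p : 0 < p <= 1 -> (quantile P M p <= t) = (p <= fine F).
  by move=> p01; rewrite quantile_le// -lee_fin fineK.
rewrite -(fineK Ffin); apply/eqP; rewrite eq_le; apply/andP; split.
  apply: (@le_trans _ _ (lambda `[0, fine F]%classic)).
    apply: le_measure; rewrite ?inE//; first exact: measurableI.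
    move=> p [] /=; rewrite !in_itv/= => Qp /andP[p0' p1]; rewrite p0'/=.
    move: p0'; rewrite le_eqVlt => /orP[/eqP <-//|p0].
    by have := QF p; rewrite p0 p1 Qp => /(_ isT) <-.
  by rewrite lebesgue_measure_itv/= lte_fin; case: ifPn; rewrite ?sube0// lee_fin.
apply: (@le_trans _ _ (lambda `]0, fine F]%classic)).
  rewrite lebesgue_measure_itv/= lte_fin; case: ifPn; rewrite ?sube0// -leNgt.
  by move=> F0'; rewrite lee_fin.
apply: le_measure; rewrite ?inE//; first exact: measurableI.
move=> p /=; rewrite !in_itv/= => /andP[p0 pF].
have p1 : p <= 1 by exact: le_trans F1.
by have := QF p; rewrite p0 p1 pF => /(_ isT) ->; rewrite (ltW p0).
Qed.

End Quantiles.

(** * Helly's selection theorem *)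

Section Helly.
Context {R : realType}.
Notation lambda := (@lebesgue_measure R).

(** The condition [n <= tau n] stands in for strict monotonicity of the extraction: it is stable
    under composition and sends tails into tails. *)
Lemma bounded_cvg_subseq (v : nat -> R) (M : R) : (forall n, `|v n| <= M) ->
  exists tau : nat -> nat, (forall n, (n <= tau n)%N) /\ cvgn (v \o tau).
Proof.
move=> vM; have [|f fi fc] := bolzano_weierstrass (u_ := v).
  exists M; split; first exact: num_real.
  by move=> x Mx n _ /=; exact: le_trans (vM n) (ltW Mx).
exists f; split => //; elim => // n IH.
apply: leq_ltn_trans IH _; rewrite ltnNge; apply/negP => fn.
by have := fi n.+1 n; rewrite ltnn; move: fn; rewrite leEnat => ->.
Qed.

(** Cantor's diagonal argument: column [k] converges along [S k.+1], and every later extraction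
    refines this one. *)
Lemma diagonal_subseq (x : nat -> nat -> R) (M : R) :
  (forall n k, `|x n k| <= M) ->
  exists sigma : nat -> nat, (forall n, (n <= sigma n)%N) /\
    forall k, cvgn (fun n => x (sigma n) k).
Proof.
move=> xM.
have /choice[T HT] : forall p : (nat -> nat) * nat, exists tau : nat -> nat,
    (forall n, (n <= tau n)%N) /\ cvgn (fun n => x (p.1 (tau n)) p.2).
  by move=> [s k]; exact: (@bounded_cvg_subseq (fun n => x (s n) k) M).
pose S := fix S (k : nat) : nat -> nat :=
  if k is k'.+1 then S k' \o T (S k', k') else id.
have Sge k n : (n <= S k n)%N.
  elim: k n => //= k IH n; exact: leq_trans ((HT (S k, k)).1 n) (IH _).
have Ssub k m n : exists2 j, (n <= j)%N & S (m + k)%N n = S k j.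
  elim: m n => [|m IH] n; first by exists n.
  have [j nj /= ->] := IH (T (S (m + k)%N, (m + k)%N) n).
  by exists j => //; apply: leq_trans nj; exact: (HT _).1.
(* For [n >= k], [Ssub] exhibits [S n.+1 n] as a value of [S k.+1] at an index at least [n], so the
   diagonal inherits the limit of column [k]. *)
exists (fun n => S n.+1 n); split; first by move=> n; exact: Sge.
move=> k; have [_ /cvg_ex[/= L HL]] := HT (S k, k).
apply/cvg_ex; exists L; apply/cvgrPdist_lt => e e0.
move/cvgrPdist_lt : HL => /(_ e e0)[N _ HN].
exists (maxn N k) => // n /= Nkn.
have /andP[Nn kn] : (N <= n)%N && (k <= n)%N by rewrite -geq_max.
have [j nj] := Ssub k.+1 (n - k)%N n; rewrite addnS subnK// => /= ->.
by apply: HN => /=; exact: leq_trans nj.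
Qed.

(** A monotone function has one-sided limits, so the negation of [discontinuity] says that they
    agree; [a] and [b] are taken where [f] is within [e / 2] of the common limit. *)
Lemma nd_continuity_point (f : R -> R) (p : R) :
  {homo f : x y / x <= y} -> ~ discontinuity f p -> forall e, 0 < e ->
  exists a b, [/\ a < p, p < b & f b - f a < e].
Proof.
move=> nd npd e e0.
have cl : cvg (f x @[x --> p^'-]).
  apply: nondecreasing_at_left_is_cvgr.
    by apply: nearW => z x y _ _; exact: nd.
  by apply: nearW => z; exists (f p) => _ [x /= + <-]; rewrite in_itv/= => /andP[_ xp]; exact/nd/ltW.
have cr : cvg (f x @[x --> p^'+]).
  apply: nondecreasing_at_right_is_cvgr.
    by apply: nearW => z x y _ _; exact: nd.
  by apply: nearW => z; exists (f p) => _ [x /= + <-]; rewrite in_itv/= => /andP[px _]; exact/nd/ltW.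
have llr : lim (f x @[x --> p^'-]) = lim (f x @[x --> p^'+]).
  by apply/eqP; apply: contrapT => /negP lr; apply: npd; split.
have e2 : 0 < e / 2 by lra.
move/cvgrPdist_lt : cl => /(_ _ e2) Hl; move/cvgrPdist_lt : cr => /(_ _ e2) Hr.
rewrite -llr in Hr; set L := lim _ in Hl Hr.
have [a [ap La]] : exists a, a < p /\ `|L - f a| < e / 2.
  near (p^'-) => a; exists a; split; near: a => //; exact: nbhs_left_lt.
have [b [pb Lb]] : exists b, p < b /\ `|L - f b| < e / 2.
  near (p^'+) => b; exists b; split; near: b => //; exact: nbhs_right_gt.
exists a, b; split => //; move: La Lb; rewrite !ltr_norml; lra.
Unshelve. all: by end_near. Qed.

(** A diagonal subsequence converges at every rational, and [q' p] is the supremum of these limits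
    over the rationals below [p]. Where [q'] does not jump, monotonicity squeezes [q (sigma n) p]
    between values at two nearby rationals. *)
Lemma helly (q : nat -> R -> R) (M : R) :
  (forall n, {homo q n : x y / x <= y}) -> (forall n p, `|q n p| <= M) ->
  exists (sigma : nat -> nat) (q' : R -> R),
    [/\ forall n, (n <= sigma n)%N, {homo q' : x y / x <= y},
        forall p, `|q' p| <= M &
        forall p, ~ discontinuity q' p -> (fun n => q (sigma n) p) @ \oo --> q' p].
Proof.
move=> nd qM.
(* An enumeration of the rationals; numbers that code no rational default to 0. *)
pose rt (k : nat) : R := ratr (odflt 0 (unpickle k : option rat)).
have rtP a b : a < b -> exists k, a < rt k < b.
  move=> /rat_in_itvoo[r rab]; exists (pickle r); rewrite /rt pickleK/=.
  by move: rab; rewrite in_itv.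
have [sigma [sge sc]] := @diagonal_subseq (fun n k => q n (rt k)) M (fun n k => qM n _).
pose L k := lim ((fun n => q (sigma n) (rt k)) @ \oo).
have cL k : (fun n => q (sigma n) (rt k)) @ \oo --> L k by exact: sc.
have LM k : `|L k| <= M.
  rewrite ler_norml; apply/andP; split.
    by apply: limr_ge => //; apply: nearW => n; have := qM (sigma n) (rt k); rewrite ler_norml => /andP[].
  by apply: limr_le => //; apply: nearW => n; have := qM (sigma n) (rt k); rewrite ler_norml => /andP[].
have Lnd k k' : rt k <= rt k' -> L k <= L k'.
  by move=> kk; apply: ler_lim => //; apply: nearW => n; exact: nd.
pose S p := [set L k | k in [set k | rt k < p]].
have S0 p : S p !=set0.
  have [|k /andP[_ kp]] := rtP (p - 1) p; first lra.
  by exists (L k); exists k.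
have Sub p : has_ubound (S p).
  by exists M => _ [k _ <-]; have := LM k; rewrite ler_norml => /andP[].
pose q' p := sup (S p).
have q'ge k p : rt k < p -> L k <= q' p.
  by move=> kp; apply: sup_upper_bound; [split|exists k].
have q'le k p : p <= rt k -> q' p <= L k.
  move=> kp; apply: ge_sup => // _ [k' /= k'p <-]; apply: Lnd.
  by apply: ltW; exact: lt_le_trans kp.
have nd' : {homo q' : x y / x <= y}.
  move=> x y xy; apply: sup_le; [|exact: S0|by split].
  move=> _ [k /= kx <-]; exists (L k); split => //.
  by exists k => //=; exact: lt_le_trans xy.
exists sigma, q'; split => //.
- move=> p; rewrite ler_norml; apply/andP; split.
    have [_ [k /= kp _]] := S0 p; apply: le_trans (q'ge k p kp).
    by have := LM k; rewrite ler_norml => /andP[].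
  by apply: ge_sup => // _ [k _ <-]; have := LM k; rewrite ler_norml => /andP[].
move=> p dp; apply/cvgrPdist_lt => e e0.
have e2 : 0 < e / 2 by lra.
have [a [b [ap pb ab]]] := nd_continuity_point nd' dp e2.
have [k /andP[ak kp]] := rtP _ _ ap.
have [k' /andP[pk' k'b]] := rtP _ _ pb.
have ak' := q'le _ _ (ltW ak); have k'b' := q'ge _ _ k'b.
have pa := nd' _ _ (ltW ap); have pb' := nd' _ _ (ltW pb).
move/cvgrPdist_lt : (cL k) => /(_ _ e2) H1.
move/cvgrPdist_lt : (cL k') => /(_ _ e2) H2.
near=> n.
have : `|L k - q (sigma n) (rt k)| < e / 2 by near: n.
have : `|L k' - q (sigma n) (rt k')| < e / 2 by near: n.
have := nd (sigma n) _ _ (ltW kp); have := nd (sigma n) _ _ (ltW pk').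
rewrite !ltr_norml; lra.
Unshelve. all: by end_near. Qed.

End Helly.

Section Bounded_integrals.
Context {d} {T : measurableType d} {R : realType} (P : probability T R).

Lemma bounded_integrable (D : set T) (f : T -> R) (B : R) :
  measurable D -> measurable_fun D f -> (forall x, D x -> `|f x| <= B) ->
  P.-integrable D (EFin \o f).
Proof.
move=> mD mf fB; apply: measurable_bounded_integrable => //.
  by rewrite -ge0_fin_numE// fin_num_measure.
exists B; split; first exact: num_real.
by move=> x Bx y Dy /=; exact: le_trans (fB y Dy) (ltW Bx).
Qed.

Lemma bounded_Rintegral_cvg (f_ : nat -> T -> R) (f : T -> R) (B : R) :
  (forall n, measurable_fun setT (f_ n)) -> measurable_fun setT f ->
  (forall n x, `|f_ n x| <= B) ->
  {ae P, forall x, (fun n => f_ n x) @ \oo --> f x} ->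
  (fun n => \int[P]_x f_ n x) @ \oo --> \int[P]_x f x.
Proof.
move=> mf_ mf f_B f_f.
have [|||||If _ H] := @dominated_convergence _ T R P setT measurableT
    (fun n => EFin \o f_ n) (EFin \o f) (cst B%:E).
- by move=> n; exact/measurable_EFinP.
- exact/measurable_EFinP.
- apply: (@filterS _ _ (ae_filter_ringOfSetsType P)) f_f => x fx _.
  by apply/cvg_EFin => //; apply: nearW.
- by apply: (@bounded_integrable _ (cst B) `|B|).
- by apply: (aeW P) => x n _ /=; rewrite lee_fin.
apply: fine_cvg; rewrite fineK//; exact: integrable_fin_num.
Qed.

End Bounded_integrals.

(** * Weak* limits of measures and upper semicontinuous integrands *)

Section Compactness.
Context {R : realType}.
Notation lambda := (@lebesgue_measure R).
Notation U01 := (uniform_prob (@ltr01 R)).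
Variable X : set R.
Hypothesis cX : compact X.

Let clX : closed X. Proof. by apply: compact_closed => //; exact: Rhausdorff. Qed.

Let mX : measurable X. Proof. exact: compact_measurable. Qed.

Lemma compact_sub_itv : exists M, X `<=` `[- M, M].
Proof.
have [M [_ /(_ (M + 1)) HM]] := compact_bounded cX.
exists (M + 1) => x Xx; rewrite /= in_itv/= -ler_norml; apply: HM => //; lra.
Qed.

Lemma within_continuous_bounded (f : R -> R) : {within X, continuous f} ->
  exists B, forall x, X x -> `|f x| <= B.
Proof.
move=> cf; have [M [_ /(_ (M + 1)) HM]] := compact_bounded (continuous_compact cf cX).
by exists (M + 1) => x Xx; apply: HM; [lra|exists x].
Qed.

Lemma within_continuous_eps (f : R -> R) : {within X, continuous f} ->
  forall x, X x -> forall e, 0 < e -> exists2 d : R, 0 < d &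
    forall y, X y -> `|y - x| < d -> `|f y - f x| < e.
Proof.
move=> /subspace_continuousP cf x Xx e e0.
have /cvgrPdist_lt/(_ e e0) := cf x Xx.
rewrite near_withinE => /nbhs_ballP[d /= d0 H]; exists d => // y Xy yx.
by rewrite distrC; apply: H => //; rewrite /ball/= distrC.
Qed.

Lemma inDelta_itv (P : probability R R) (M : R) : X `<=` `[- M, M] -> inDelta X P -> P `[- M, M]%classic = 1%E.
Proof.
move=> XM PX; apply/eqP; rewrite eq_le probability_le1//= -PX.
by apply: le_measure; rewrite ?inE.
Qed.

Lemma Rintegral_law (q : R -> R) (mq : measurable_fun setT q) (f : R -> R) (B : R) :
  measurable_fun X f -> (forall x, X x -> `|f x| <= B) ->
  \int[law mq]_(x in X) f x = \int[U01]_p (f \_ X) (q p).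
Proof.
move=> mf fB.
have mfX : measurable_fun setT (f \_ X) by apply/(measurable_restrictT _ _).1.
rewrite Rintegral_mkcond /Rintegral; congr fine.
apply: (@integral_distribution _ _ _ R _ U01 (mfun_of mq) (EFin \o f \_ X)).
  exact/measurable_EFinP.
apply: (@bounded_integrable _ _ _ U01 setT ((f \_ X) \o q) (Num.max 0 B)) => //.
  exact: measurableT_comp mfX mq.
move=> p _ /=; rewrite patchE le_max; case: ifPn; last by rewrite normr0 lexx.
by rewrite inE => /fB ->; rewrite orbT.
Qed.

Lemma eq_Rintegral_peq (P1 P2 : probability R R) (D : set R) (f : R -> R) :
  peq P1 P2 -> \int[P1]_(x in D) f x = \int[P2]_(x in D) f x.
Proof. by move=> P12; congr fine; apply: eq_measure_integral => A mA _; exact: P12. Qed.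

Definition usc_on (h : R -> R) := forall x, X x -> forall e, 0 < e ->
  exists2 d : R, 0 < d & forall y, X y -> `|y - x| < d -> h y < h x + e.

(** Each [m_ n] is the law of its quantile function under the uniform distribution. Along a Helly
    subsequence the quantile functions converge almost everywhere, [m] is the law of their limit,
    and weak* convergence is dominated convergence. The last clause serves payoffs that are only
    upper semicontinuous. *)
Lemma Delta_seq_compact (m_ : nat -> probability R R) :
  (forall n, inDelta X (m_ n)) ->
  exists (sigma : nat -> nat) (m : probability R R),
    [/\ forall n, (n <= sigma n)%N, inDelta X m,
        weak_cvg X (m_ \o sigma) m &
        forall (h : R -> R) (B : R) (b_ : nat -> R) (b : R),
          measurable_fun X h -> (forall x, X x -> `|h x| <= B) -> usc_on h ->
          (forall n, b_ n <= \int[m_ (sigma n)]_(x in X) h x) ->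
          b_ @ \oo --> b -> b <= \int[m]_(x in X) h x].
Proof.
move=> mD.
have [M XM] := compact_sub_itv.
pose q n := quantile (m_ n) M.
have mM n := inDelta_itv XM (mD n).
have qM n p : `|q n p| <= M by rewrite ler_norml quantile_itv.
have [sigma [q' [sge nd' q'M q'c]]] := @helly R q M (fun n => quantile_nd (mM n)) qM.
have mq n : measurable_fun setT (q n) := measurable_quantile (mM n).
have mq' : measurable_fun setT q' by exact: nondecreasing_measurable.
have lawq n : peq (law (mq n)) (m_ n) by exact: law_quantile.
(* The monotone [q'] has countably many jumps in []-1, 2[], an open interval around [[0, 1]],
   outside which the uniform law has no mass. *)
have aec : {ae U01, forall p, (fun n => q (sigma n) p) @ \oo --> q' p}.
  pose N := [set p | p \in `]-1, 2[%R /\ discontinuity q' p].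
  have cN : countable N by apply: discontinuity_countable => x y _ _; exact: nd'.
  have mN : measurable N by exact: countable_measurable.
  exists (N `|` ~` `[0, 1]); split.
  - by apply: measurableU => //; exact: measurableC.
  - rewrite uniform01E; last by apply: measurableU => //; exact: measurableC.
    rewrite setIUl setICl setU0; apply/eqP; rewrite eq_le measure_ge0 andbT.
    rewrite -(countable_lebesgue_measure0 cN).
    by apply: le_measure; rewrite ?inE//; exact: measurableI.
  - move=> p /= pc; apply: contrapT => pN; apply: pc; apply: q'c => dp; apply: pN.
    have [p01|p01] := pselect (`[0, 1]%classic p); last by right.
    left; split => //; move: p01; rewrite /= !in_itv/=; lra.
have aeX n : {ae U01, forall p, X (q n p)}.
  exists (q n @^-1` (~` X)); split => //.
  - by rewrite -[X in measurable X]setTI; apply: (mq n) => //; exact: measurableC.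
  - have := lawq n (~` X) (measurableC mX); rewrite lawE => ->.
    by rewrite probability_setC// (mD n) subee.
have aeX' : {ae U01, forall p, X (q' p)}.
  have /ae_foralln aeXn := fun n => aeX (sigma n).
  apply: (@filterS2 _ _ (ae_filter_ringOfSetsType U01)) aec aeXn => p pc pX.
  by have := closed_cvg _ clX _ _ pc; apply; exact: nearW.
pose m := law mq'.
have mXD : inDelta X m.
  have [N [mN N0 NX]] := aeX'.
  have mqX : measurable (q' @^-1` X) by rewrite -[X in measurable X]setTI; exact: (mq' measurableT).
  have C0 : U01 (~` (q' @^-1` X)) = 0%E.
    apply/eqP; rewrite eq_le measure_ge0 andbT -N0.
    by apply: le_measure; rewrite ?inE//; exact: measurableC.
  have mC0 : m (~` X) = 0%E by exact: C0.
  by have := probability_setC m (measurableC mX); rewrite setCK mC0 sube0.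
(* Dominated convergence shared by both clauses: [g_ n] will be [f] along the quantiles in the
   first, a pointwise maximum in the second. *)
have step (f : R -> R) (g_ : nat -> R -> R) B : measurable_fun X f ->
    (forall x, X x -> `|f x| <= B) -> (forall n, measurable_fun setT (g_ n)) ->
    (forall n p, `|g_ n p| <= B) ->
    {ae U01, forall p, X (q' p) -> (forall n, X (q (sigma n) p)) ->
      (fun n => q (sigma n) p) @ \oo --> q' p -> (fun n => g_ n p) @ \oo --> f (q' p)} ->
    (fun n => \int[U01]_p g_ n p) @ \oo --> \int[m]_(x in X) f x.
  move=> mf fB mg gB aeg; rewrite (@Rintegral_law _ _ _ B)//.
  have mfX : measurable_fun setT (f \_ X) by apply/(measurable_restrictT _ _).1.
  apply: (@bounded_Rintegral_cvg _ _ _ U01 _ _ B) => //.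
    exact: measurableT_comp mfX mq'.
  have /ae_foralln aeXn := fun n => aeX (sigma n).
  apply: (@filterS3 _ _ (ae_filter_ringOfSetsType U01)) aec aeXn
    (@filterI _ _ (ae_filter_ringOfSetsType U01) _ _ aeg aeX') => p pc pX [pg pX'].
  by rewrite patchE mem_set//; exact: pg.
exists sigma, m; split => //.
- move=> f cf.
  have mf : measurable_fun X f by exact: subspace_continuous_measurable_fun.
  have [B0 fB0] := within_continuous_bounded cf.
  pose B := Num.max 0 B0.
  have fB x : X x -> `|f x| <= B by move=> /fB0 H; rewrite le_max H orbT.
  have -> : (fun n => \int[(m_ \o sigma) n]_(x in X) f x) =
      (fun n => \int[U01]_p (f \_ X) (q (sigma n) p)).
    apply/funext => n; rewrite -(eq_Rintegral_peq _ _ (lawq (sigma n))).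
    exact: Rintegral_law fB.
  have mfX : measurable_fun setT (f \_ X) by apply/(measurable_restrictT _ _).1.
  apply: (step _ _ B) => //.
  + by move=> n; exact: measurableT_comp mfX (mq _).
  + move=> n p; rewrite patchE; case: ifPn => [/[!inE] /fB//|_].
    by rewrite normr0 le_max lexx.
  + apply: (aeW U01) => p Xq' Xq qc; apply/cvgrPdist_lt => e e0.
    have [d d0 H] := within_continuous_eps cf Xq' e0.
    move/cvgrPdist_lt : qc => /(_ d d0) qc; near=> n.
    rewrite patchE mem_set//= distrC; apply: H => //; rewrite distrC.
    by near: n.
- move=> h B0 b_ b mh hB0 uh bh bb.
  pose B := Num.max 0 B0.
  have hB x : X x -> `|h x| <= B by move=> /hB0 H; rewrite le_max H orbT.
  have mhX : measurable_fun setT (h \_ X) by apply/(measurable_restrictT _ _).1.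
  have hXB x : `|(h \_ X) x| <= B.
    rewrite patchE; case: ifPn => [/[!inE] /hB//|_].
    by rewrite normr0 le_max lexx.
  have mhq n : measurable_fun setT (fun p => (h \_ X) (q n p)).
    exact: measurableT_comp mhX (mq _).
  have mhq' : measurable_fun setT (fun p => (h \_ X) (q' p)).
    exact: measurableT_comp mhX mq'.
  (* Upper semicontinuity makes these maxima converge, unlike the functions [h o q_n]. *)
  pose g_ n p := Num.max ((h \_ X) (q (sigma n) p)) ((h \_ X) (q' p)).
  have mg n : measurable_fun setT (g_ n) by exact: measurable_maxr.
  have gB n p : `|g_ n p| <= B by rewrite /g_ /Num.max; case: ifPn.
  have gh : (fun n => \int[U01]_p g_ n p) @ \oo --> \int[m]_(x in X) h x.
    apply: (step _ _ B) => //.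
    apply: (aeW U01) => p Xq' Xq qc; apply/cvgrPdist_lt => e e0.
    have [d d0 H] := uh _ Xq' _ e0.
    move/cvgrPdist_lt : qc => /(_ d d0) qc; near=> n.
    have : h (q (sigma n) p) < h (q' p) + e.
      by apply: H => //; rewrite distrC; near: n.
    rewrite /g_ !patchE !mem_set// /Num.max; case: ifPn; rewrite -?leNgt ltr_norml; lra.
  rewrite -(cvg_lim _ bb)// -(cvg_lim _ gh)//; apply: ler_lim.
  + by apply/cvg_ex; exists b.
  + by apply/cvg_ex; eexists; exact: gh.
  apply: nearW => n; apply: le_trans (bh n) _.
  rewrite -(eq_Rintegral_peq _ _ (lawq (sigma n))) (@Rintegral_law _ _ _ B)//.
  apply: le_Rintegral => //.
  + by apply: (@bounded_integrable _ _ _ U01 _ _ B) => //; exact: mhq.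
  + by apply: (@bounded_integrable _ _ _ U01 _ _ B) => //; exact: mg.
  + by move=> p _; rewrite /g_ le_max lexx.
Unshelve. all: by end_near. Qed.

End Compactness.

(** * First-order conditions *)

Section First_order_conditions.
Context {R : realType}.

Lemma mixture_exists (P Q : probability R R) : exists mix : R -> probability R R,
  forall e, 0 <= e <= 1 -> is_mixture (mix e) P Q e.
Proof.
suff H e : exists N : probability R R, 0 <= e <= 1 -> is_mixture N P Q e.
  by have /choice[mix Hmix] := H; exists mix.
have [e01|e01] := boolP (0 <= e <= 1); last by exists P.
have /andP[e0 e1] := e01.
have e1' : 0 <= 1 - e by lra.
pose m : {measure set R -> \bar R} := measure_add (mscale (NngNum e1') P) (mscale (NngNum e0) Q).
have mE A : m A = ((1 - e)%:E * P A + e%:E * Q A)%E by exact: measure_addE.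
have m1 : m setT = 1%E.
  by rewrite mE !probability_setT !mule1 -EFinD subrK.
(* [m] has total mass 1, so normalizing it only packages it as a probability. *)
exists (mnormalize m P : probability R R) => _ A mA.
by rewrite -mE /= /mnormalize m1 onee_eq0/= invr1 mule1.
Qed.

Variable X : set R.
Hypothesis mX : measurable X.

Lemma mixture_inDelta (N P Q : probability R R) e :
  is_mixture N P Q e -> inDelta X P -> inDelta X Q -> inDelta X N.
Proof. by move=> NPQ PX QX; rewrite /inDelta NPQ// PX QX !mule1 -EFinD subrK. Qed.

Lemma Rintegral_const_inDelta (P : probability R R) (k : R) : inDelta X P ->
  \int[P]_(x in X) k = k.
Proof. by move=> PX; rewrite Rintegral_cst// -[RHS]mulr1; congr (_ * _); exact: (congr1 fine PX). Qed.

(** Additivity in the measure is applied to a nonnegative integrand, hence the shift of [f] by [B];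
    the shift cancels because the three measures have mass 1 on [X]. *)
Lemma Rintegral_mixture (N P Q : probability R R) e (f : R -> R) (B : R) :
  0 <= e <= 1 ->
  is_mixture N P Q e -> inDelta X P -> inDelta X Q ->
  measurable_fun X f -> (forall x, X x -> `|f x| <= B) ->
  \int[N]_(x in X) f x = (1 - e) * \int[P]_(x in X) f x + e * \int[Q]_(x in X) f x.
Proof.
move=> /andP[e0 e1] NPQ PX QX mf fB.
have NX := mixture_inDelta NPQ PX QX.
have e1' : 0 <= 1 - e by lra.
have fB0 x : X x -> 0 <= f x + B.
  by move=> /fB; rewrite ler_norml => /andP[]; lra.
have mfB : measurable_fun X (fun x => f x + B) by exact: measurable_funD.
have int (S : probability R R) : S.-integrable X (EFin \o f).
  exact: bounded_integrable fB.
have intB (S : probability R R) : S.-integrable X (EFin \o (fun=> B)).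
  by apply: (@bounded_integrable _ _ _ _ _ _ `|B|).
have shift (S : probability R R) : inDelta X S ->
    \int[S]_(x in X) (f x + B) = \int[S]_(x in X) f x + B.
  by move=> SX; rewrite (RintegralD mX (int S) (intB S)); congr (_ + _); exact: Rintegral_const_inDelta.
suff : \int[N]_(x in X) (f x + B) =
    (1 - e) * \int[P]_(x in X) (f x + B) + e * \int[Q]_(x in X) (f x + B).
  by rewrite !shift//; lra.
pose m := measure_add (mscale (NngNum e1') P) (mscale (NngNum e0) Q).
have fin (S : probability R R) : (\int[S]_(x in X) (f x + B)%:E)%E \is a fin_num.
  apply: integrable_fin_num => //.
  apply: (@bounded_integrable _ _ _ _ _ (fun x => f x + B) (B + `|B|)) => // x Xx.
  by apply: le_trans (ler_normD _ _) _; rewrite lerD2r fB.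
rewrite /Rintegral (@eq_measure_integral _ _ _ _ m); last first.
  by move=> A mA _; apply: etrans (NPQ A mA) _; apply/esym; exact: measure_addE.
have mE : measurable_fun X (fun x => (f x + B)%:E) by exact/measurable_EFinP.
have ge x : X x -> (0 <= (f x + B)%:E)%E by move=> /fB0; rewrite lee_fin.
rewrite ge0_integral_measure_add// !ge0_integral_mscale//.
by rewrite fineD ?fineM//= fin_numM.
Qed.

Variables (C : probability R R -> R) (c : R -> R) (h : R -> R) (m : probability R R).
Hypothesis mD : inDelta X m.
Hypothesis cvxC : forall m1 m2 nu l, inDelta X m1 -> inDelta X m2 -> inDelta X nu ->
  0 <= l <= 1 -> is_mixture nu m1 m2 l -> C nu <= (1 - l) * C m1 + l * C m2.
Hypothesis mc : measurable_fun X c.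
Hypothesis bc : exists B, forall x, X x -> `|c x| <= B.
Hypothesis mh : measurable_fun X h.
Hypothesis bh : exists B, forall x, X x -> `|h x| <= B.
Hypothesis dirC : forall (m' : probability R R) (mix : R -> probability R R), inDelta X m' ->
  (forall e, 0 < e <= 1 -> is_mixture (mix e) m m' e) ->
  (fun e => (C (mix e) - C m) / e) @ (0:R)^'+ -->
    (\int[m']_(x in X) c x - \int[m]_(x in X) c x).

Let intc (S : probability R R) : S.-integrable X (EFin \o c).
Proof. by have [B cB] := bc; exact: bounded_integrable cB. Qed.

Let inth (S : probability R R) : S.-integrable X (EFin \o h).
Proof. by have [B hB] := bh; exact: bounded_integrable hB. Qed.

(** Moving a fraction [e] from [m] towards [nu] changes the integral of [h] linearly in [e].
    Optimality divided by [e] bounds this slope by the difference quotient of [C], and [dirC] gives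
    the limit. *)
Lemma maximizer_foc :
  (forall m', inDelta X m' -> \int[m']_(x in X) h x - C m' <= \int[m]_(x in X) h x - C m) ->
  forall nu : probability R R, inDelta X nu ->
    \int[nu]_(x in X) (h x - c x) <= \int[m]_(x in X) (h x - c x).
Proof.
move=> max nu nuX; rewrite (RintegralB mX (inth nu) (intc nu)) (RintegralB mX (inth m) (intc m)).
have [mix mixP] := mixture_exists m nu.
have mixP' e : 0 < e <= 1 -> is_mixture (mix e) m nu e.
  by move=> /andP[e0 e1]; apply: mixP; rewrite ltW.
have cv := dirC nuX mixP'.
suff : \int[nu]_(x in X) h x - \int[m]_(x in X) h x <=
    \int[nu]_(x in X) c x - \int[m]_(x in X) c x by lra.
rewrite -(cvg_lim _ cv)//; apply: limr_ge; first by apply/cvg_ex; eexists; exact: cv.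
near=> e.
have e0 : 0 < e by near: e; exact: nbhs_right_gt.
have e1 : e <= 1 by near: e; exact: nbhs_right_le.
have mm := mixP' e; rewrite e0 e1 in mm; have {}mm := mm isT.
have := max _ (mixture_inDelta mm mD nuX).
have [B hB] := bh.
have e01 : 0 <= e <= 1 by rewrite ltW.
rewrite (Rintegral_mixture e01 mm mD nuX mh hB) => H.
rewrite ler_pdivlMr//; lra.
Unshelve. all: by end_near. Qed.

(** Convexity bounds the difference quotients of [C] from [m] towards [nu], hence their limit, by
    [C nu - C m]; the linearized inequality thus implies the true one. *)
Lemma foc_maximizer :
  (forall nu : probability R R, inDelta X nu ->
    \int[nu]_(x in X) (h x - c x) <= \int[m]_(x in X) (h x - c x)) ->
  forall m', inDelta X m' -> \int[m']_(x in X) h x - C m' <= \int[m]_(x in X) h x - C m.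
Proof.
move=> foc nu nuX; have := foc nu nuX; rewrite (RintegralB mX (inth nu) (intc nu)) (RintegralB mX (inth m) (intc m)) => focnu.
have [mix mixP] := mixture_exists m nu.
have mixP' e : 0 < e <= 1 -> is_mixture (mix e) m nu e.
  by move=> /andP[e0 e1]; apply: mixP; rewrite ltW.
have cv := dirC nuX mixP'.
suff : \int[nu]_(x in X) c x - \int[m]_(x in X) c x <= C nu - C m by lra.
rewrite -(cvg_lim _ cv)//; apply: limr_le; first by apply/cvg_ex; eexists; exact: cv.
near=> e.
have e0 : 0 < e by near: e; exact: nbhs_right_gt.
have e1 : e <= 1 by near: e; exact: nbhs_right_le.
have mm := mixP' e; rewrite e0 e1 in mm; have {}mm := mm isT.
have := cvxC mD nuX (mixture_inDelta mm mD nuX) _ mm.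
rewrite (ltW e0) e1 => /(_ isT) H.
rewrite ler_pdivrMr//; lra.
Unshelve. all: by end_near. Qed.

End First_order_conditions.

(** * Envelope theorem *)

Section Envelope.
Context {R : realType}.
Notation lambda := (@lebesgue_measure R).

(** Within the radius [d] for tolerance 1 the derivative gives the slope [|f' t| + 1]; farther away
    the increment is at most [2 * M] and [|s - t| >= d]. The constant depends on [t]. *)
Lemma deriv_lin_bound (a b M : R) (f f' : R -> R) :
  has_deriv_on a b f f' -> (forall t, a <= t <= b -> `|f t| <= M) ->
  forall t, a <= t <= b -> exists k : R, forall s, a <= s <= b -> `|f s - f t| <= k * `|s - t|.
Proof.
move=> df fM t tab; have [d d0 H] := has_deriv_eps df tab ltr01.
have M0 : 0 <= M by exact: le_trans (normr_ge0 _) (fM t tab).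
have Md0 : 0 <= 2 * M / d by rewrite divr_ge0 ?mulr_ge0// ltW.
exists (`|f' t| + 1 + 2 * M / d) => s sab.
have [->|st] := eqVneq s t; first by rewrite !subrr normr0 mulr0.
have [std|std] := ltP `|s - t| d.
  have := H (s - t); rewrite subr_eq0 st std addrC subrK sab => /(_ isT isT isT) Hs.
  have st0 : 0 < `|s - t| by rewrite normr_gt0 subr_eq0.
  have : `|(f s - f t) / (s - t)| <= `|f' t| + 1.
    rewrite -[X in `|X|](subrK (f' t)); apply: le_trans (ler_normD _ _) _.
    by rewrite addrC lerD2l ltW.
  rewrite normrM normfV ler_pdivrMr// => /le_trans; apply.
  by rewrite ler_wpM2r// lerDl.
apply: le_trans (ler_normB _ _) _; apply: (@le_trans _ _ (2 * M)).
  by have := fM s sab; have := fM t tab; lra.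
apply: (@le_trans _ _ (2 * M / d * `|s - t|)).
  by rewrite -mulrA ler_peMr ?mulr_ge0// ler_pdivlMl// mulr1.
by rewrite ler_wpM2r// lerDr addr_ge0.
Qed.

(** Absolute continuity of the integral of [|g|] as a set function is applied to the union of the
    intervals, taken half-open so that neighbours sharing an endpoint stay disjoint. *)
Lemma integral_abs_cont (a b : R) (V g : R -> R) :
  lambda.-integrable setT (EFin \o g) ->
  (forall s t, a <= s -> s <= t -> t <= b -> V t - V s = \int[lambda]_(x in `[s, t]) g x) ->
  abs_cont_on a b V.
Proof.
move=> ig Vg e e0; have [d [d0 H]] := integral_normr_continuous ig e0.
exists d => // n s t st disj sumd.
pose I i := `]s i, t i]%classic.
have ing (D : set R) : measurable D -> lambda.-integrable D (EFin \o (fun x => `|g x|)).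
  move=> mD; have igD : lambda.-integrable D (EFin \o g) by exact: integrableS ig.
  exact: (integrable_abse igD).
have mA k : measurable (\big[setU/set0]_(i < k) I i : set R).
  by apply: bigsetU_measurable => i _; exact: measurable_itv.
have lA k : (k <= n)%N -> (lambda (\big[setU/set0]_(i < k) I i) <= (\sum_(i < k) (t i - s i))%:E)%E /\
    \sum_(i < k) `|V (t i) - V (s i)| <= \int[lambda]_(x in \big[setU/set0]_(i < k) I i) `|g x|.
  elim: k => [|k IH] kn.
    by rewrite !big_ord0 measure0 Rintegral_set0.
  have [IH1 IH2] := IH (ltnW kn).
  have [ask [sk tk]] := st k kn.
  rewrite !big_ord_recr/=; split.
    apply: (@le_trans _ _ (lambda (\big[setU/set0]_(i < k) I i) + lambda (I k))%E).
      by apply: measureU2; [exact: mA|exact: measurable_itv].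
    rewrite EFinD; apply: leeD => //.
    rewrite /I lebesgue_measure_itv/= lte_fin; case: ifPn => // _.
    by rewrite lee_fin subr_ge0.
  have -> : \int[lambda]_(x in \big[setU/set0]_(i < k) I i `|` I k) `|g x| =
      \int[lambda]_(x in \big[setU/set0]_(i < k) I i) `|g x| + \int[lambda]_(x in I k) `|g x|.
    apply: Rintegral_setU; [exact: mA|exact: measurable_itv| |].
      by apply: ing; apply: measurableU; [exact: mA|exact: measurable_itv].
    apply/disj_setPS => x [Ux]; rewrite /I/= in_itv/= => /andP[skx _].
    have [j jk] : exists2 j, (j < k)%N & I j x.
      by move: Ux; rewrite -bigcup_mkord => -[j /= jk Ij]; exists j.
    rewrite /I/= in_itv/= => /andP[_ xtj].
    have := disj j k; rewrite jk kn => /(_ isT) tjsk.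
    by move: skx; rewrite ltNge (le_trans xtj).
  apply: lerD => //; rewrite Vg// -Rintegral_itv_obnd_cbnd; last exact: integrableS ig.
  by apply: le_normr_Rintegral => //; exact: integrableS ig.
have [lA1 lA2] := lA n (leqnn n).
apply: le_lt_trans lA2 _; apply: H; first exact: mA.
by apply: le_lt_trans lA1 _; rewrite lte_fin.
Qed.

End Envelope.

Section Envelope_theorem.
Context {R : realType}.
Notation lambda := (@lebesgue_measure R).
Variables (X : set R) (l h M : R).
Variables (C dC : R -> probability R R -> R).
Hypothesis cX : compact X.
Hypothesis lh : l < h.
Hypothesis CM : forall th m, l <= th <= h -> inDelta X m -> `|C th m| <= M.
Hypothesis wC : forall th, l <= th <= h -> forall (mn : nat -> probability R R) m,
  (forall n, inDelta X (mn n)) -> inDelta X m -> weak_cvg X mn m ->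
  (fun n => C th (mn n)) @ \oo --> C th m.
Hypothesis decC : forall m, inDelta X m -> forall s t, l <= s -> s < t -> t <= h -> C t m < C s m.
Hypothesis derC : forall m, inDelta X m -> C1_on l h (fun t => C t m) (fun t => dC t m).

Let decC' m s t : inDelta X m -> l <= s -> s <= t -> t <= h -> C t m <= C s m.
Proof.
move=> mX ls; rewrite le_eqVlt => /orP[/eqP-> //|st] th.
by apply: ltW; exact: decC.
Qed.

(* A monotone family converging pointwise to a continuous limit converges
   uniformly (Dini), here over the weak*-compact set of measures. *)
Lemma C_right_equicontinuous t e : l <= t <= h -> 0 < e ->
  exists2 d : R, 0 < d & forall s m, inDelta X m -> t <= s <= h -> s < t + d -> C t m - C s m < e.
Proof.
move=> tlh e0; apply: contrapT => nd; have /andP[lt th] := tlh.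
(* The negation provides types within [1 / (n + 1)] of [t] and measures for which the cost still
   drops by at least [e]. *)
have H n : exists p : R * probability R R,
    [/\ inDelta X p.2, t <= p.1 <= h, p.1 < t + n.+1%:R^-1 & e <= C t p.2 - C p.1 p.2].
  apply: contrapT => np; apply: nd; exists n.+1%:R^-1; first by rewrite invr_gt0.
  move=> s m mX tsh std; rewrite ltNge; apply/negP => eC.
  by apply: np; exists (s, m).
have [p Hp] := choice H.
have p2X n : inDelta X (p n).2 by have [] := Hp n.
have [sigma [m [sge mX wm _]]] := Delta_seq_compact cX p2X.
have [Eth|tlth] := eqVneq t h.
  have [_ /andP[h1 h2] _] := Hp 0%N.
  by rewrite (@le_anti _ _ (p 0%N).1 t) ?h1 ?andbT ?Eth// subrr leNgt e0.
have {th tlth} th : t < h by rewrite lt_neqAle tlth.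
(* For fixed [s > t] the types of the sequence eventually lie below [s], so by monotonicity the drop
   down to [s] is at least [e] too; this survives the weak* limit. *)
have key s : t < s -> s <= h -> e <= C t m - C s m.
  move=> ts sh; have st0 : 0 < s - t by rewrite subr_gt0.
  have lsh : l <= s <= h by rewrite sh andbT (le_trans lt)// ltW.
  have cv : (fun n => C t (p (sigma n)).2 - C s (p (sigma n)).2) @ \oo --> C t m - C s m.
    by apply: cvgB; [apply: (wC tlh)|apply: (wC lsh)].
  rewrite -(cvg_lim _ cv)//; apply: limr_ge; first by apply/cvg_ex; eexists; exact: cv.
  near=> n.
  have [_ /andP[h1 h2] h3 h4] := Hp (sigma n).
  apply: le_trans h4 _; rewrite lerD2l lerN2; apply: decC' => //.
    exact: le_trans lt h1.
  apply: ltW; apply: lt_le_trans h3 _; rewrite -lerBrDl.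
  apply: (@le_trans _ _ (n.+1%:R^-1)).
    by rewrite lef_pV2 ?posrE// ler_nat ltnS sge.
  near: n; apply: filterS (near_infty_natSinv_lt (PosNum st0)) => n; exact: ltW.
have [k Hk] := deriv_lin_bound (derC mX).1 (fun t th => CM th mX) tlh.
pose k' := `|k| + 1.
have k'0 : 0 < k' by rewrite /k' ltr_wpDl.
(* For this [s] the linear bound at [t] leaves a drop of at most [e / 2], contradicting [key]. *)
pose s := Num.min h (t + e / (2 * k')).
have ek : 0 < e / (2 * k') by rewrite divr_gt0// mulr_gt0.
have ts : t < s by rewrite lt_min th ltrDl.
have sh : s <= h by rewrite ge_min lexx.
have se : s - t <= e / (2 * k') by rewrite lerBlDl ge_min lexx orbT.
have := key s ts sh; have := Hk s; rewrite sh andbT (le_trans lt (ltW ts)) => /(_ isT).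
rewrite (gtr0_norm (_ : 0 < s - t)) ?subr_gt0// => H1.
have : k * (s - t) <= e / 2.
  apply: (@le_trans _ _ (k' * (e / (2 * k')))).
    apply: (@le_trans _ _ (k' * (s - t))).
      rewrite ler_wpM2r ?subr_ge0 ?ltW//.
      by apply: le_lt_trans (ler_norm k) _; rewrite ltrDl.
    by rewrite ler_wpM2l// ltW.
  by rewrite le_eqVlt; apply/orP; left; apply/eqP; field; rewrite gt_eqF.
move: H1; rewrite ler_norml; lra.
Unshelve. all: by end_near. Qed.

Variables (a : R -> R) (m : R -> probability R R).
Hypothesis mX : forall t, l <= t <= h -> inDelta X (m t).
Hypothesis opt : forall s t, l <= s <= h -> l <= t <= h -> a s - C t (m s) <= a t - C t (m t).

Let V t := a t - C t (m t).

(** Optimality enters only through [opt]: no type gains by imitating another. This form covers both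
    the truthful choices and the best responses to a fixed report. *)
Lemma envelope : exists g : R -> R,
  [/\ lambda.-integrable setT (EFin \o g),
     forall s t, l <= s -> s <= t -> t <= h -> V t - V s = \int[lambda]_(x in `[s, t]) g x &
     {ae lambda, forall t : R, l <= t <= h -> dC t (m t) = - g t}].
Proof.
have ndV s t : l <= s -> s <= t -> t <= h -> V s <= V t.
  move=> ls st th; have sI : l <= s <= h by rewrite ls (le_trans st).
  have tI : l <= t <= h by rewrite th (le_trans ls).
  by have := opt sI tI; have := decC' (mX sI) ls st th; rewrite /V; lra.
have lI : l <= l <= h by rewrite lexx ltW.
have hI : l <= h <= h by rewrite lexx ltW.
have Vlh : V l < V h.
  by have := opt lI hI; have := decC (mX lI) (lexx l) lh (lexx h); rewrite /V; lra.
have Vle s t : l <= s <= h -> l <= t <= h -> V t - V s <= C s (m t) - C t (m t).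
  by move=> sI tI; have := opt tI sI; rewrite /V; lra.
have lipV t : l <= t <= h -> exists k : R, forall s, l <= s <= t -> V t - V s <= k * (t - s).
  move=> tI; have [k Hk] := deriv_lin_bound (derC (mX tI)).1 (fun t th => CM th (mX tI)) tI.
  exists k => s /andP[ls st].
  have sI : l <= s <= h by rewrite ls (le_trans st)//; case/andP: tI.
  apply: le_trans (Vle s t sI tI) _; have := Hk s sI.
  rewrite [X in k * X]distrC [X in k * X]ger0_norm ?subr_ge0// => /(le_trans _); apply.
  exact: ler_norm.
(* On the left of [t] the linear bound applies; on the right [Vle] involves the moving measure
   [m s], hence the equicontinuity over all measures. *)
have cV t e : l <= t <= h -> 0 < e -> exists2 d : R, 0 < d &
    forall s : R, l <= s <= h -> `|s - t| < d -> `|V s - V t| < e.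
  move=> tI e0; have [k Hk] := lipV t tI.
  have [d d0 Hd] := C_right_equicontinuous tI e0.
  pose k' := `|k| + 1.
  have k'0 : 0 < k' by rewrite /k' ltr_wpDl.
  exists (Num.min d (e / k')); first by rewrite lt_min d0 divr_gt0.
  move=> s sI; rewrite lt_min => /andP[sd se].
  have /andP[lt th] := tI; have /andP[ls sh] := sI.
  have [st|ts] := leP s t.
    rewrite distrC ger0_norm ?subr_ge0 ?ndV//.
    move: se; rewrite distrC ger0_norm ?subr_ge0// ltr_pdivlMr// => se.
    have := Hk s; rewrite ls st => /(_ isT) /le_lt_trans; apply.
    apply: le_lt_trans se; rewrite mulrC ler_wpM2l ?subr_ge0//.
    by apply: le_trans (ler_norm k) _; rewrite lerDl.
  rewrite ger0_norm ?subr_ge0 ?ndV ?(ltW ts)//.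
  apply: le_lt_trans (Vle t s tI sI) _; apply: Hd; first exact: mX.
    by rewrite (ltW ts) sh.
  by move: sd; rewrite ger0_norm ?subr_ge0 ?(ltW ts)//; lra.
have [g [ig Vg aeg]] := value_density lh ndV Vlh cV lipV.
exists g; split => //.
have ae1 (x : R) : {ae lambda, forall t : R, t != x}.
  exists [set x]; split => //; first by rewrite lebesgue_measure_set1.
  by move=> t /= /negP; rewrite negbK => /eqP.
apply: (@filterS3 _ _ (ae_filter_ringOfSetsType lambda)) (ae1 l) (ae1 h) aeg => t tl th Ht tI.
have /andP[lt' th'] := tI.
have lt : l < t by rewrite lt_neqAle eq_sym tl.
have {}th : t < h by rewrite lt_neqAle th.
have {Ht} := Ht; rewrite lt th => /(_ isT)/cvgrPdist_lt Ht.
have D := has_deriv_eps (derC (mX tI)).1 tI.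
suff small e : 0 < e -> `|dC t (m t) + g t| <= e + e.
  apply/eqP; rewrite -addr_eq0 -normr_le0; apply/ler_addgt0Pl => e e0; rewrite addr0.
  by have := small (e / 2); rewrite -splitr; apply; lra.
move=> e0; have [d d0 Hd] := D e e0.
have := Ht e e0; rewrite near_withinE => /nbhs_ballP[d' /= d'0 Hd'].
(* Half the minimum keeps [t + r] and [t - r] in [[l, h]] and within the radii of both limits. *)
pose r := Num.min (Num.min d d') (Num.min (t - l) (h - t)) / 2.
have r0 : 0 < r by rewrite divr_gt0// !lt_min d0 d'0 !subr_gt0 lt th.
have : r < Num.min (Num.min d d') (Num.min (t - l) (h - t)).
  by rewrite /r ltr_pdivrMr// ltr_pMr// ?ltr1n// !lt_min d0 d'0 !subr_gt0 lt th.
rewrite !lt_min => /andP[/andP[rd rd'] /andP[rl rh]].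
(* [V + C(., m t)] is minimal at [t], so its right (left) difference quotient is >= 0 (<= 0). *)
have est x : x != 0 -> `|x| = r -> l <= t + x <= h ->
    [/\ `|(C (t + x) (m t) - C t (m t)) / x - dC t (m t)| < e,
        `|g t - (V (t + x) - V t) / x| < e &
        0 <= (V (t + x) - V t) + (C (t + x) (m t) - C t (m t))].
  move=> x0 xr xI; split.
  - by apply: Hd => //; rewrite xr.
  - by apply: Hd' => //; rewrite /ball/= sub0r normrN xr.
  - by have := Vle _ _ xI tI; lra.
have [|A1 A2 A3] := est r (lt0r_neq0 r0) (gtr0_norm r0); first lra.
have rN0 : - r != 0 by rewrite oppr_eq0 gt_eqF.
have rNr : `|- r| = r by rewrite normrN gtr0_norm.
have [|B1 B2 B3] := est (- r) rN0 rNr; first lra.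
have A4 : 0 <= (V (t + r) - V t) / r + (C (t + r) (m t) - C t (m t)) / r.
  by rewrite -mulrDl divr_ge0// ltW.
have B4 : (V (t + - r) - V t) / (- r) + (C (t + - r) (m t) - C t (m t)) / (- r) <= 0.
  by rewrite -mulrDl mulr_ge0_le0// invrN oppr_le0 invr_ge0 ltW.
move: A1 A2 B1 B2; rewrite !ltr_norml ler_norml; lra.
Qed.

End Envelope_theorem.

(** * Wages, maximizers and the characterization *)

Section Oriented_integrals.
Context {R : realType}.
Notation lambda := (@lebesgue_measure R).

(** Two representatives of [f] agree almost everywhere on [[a, b]], so any of them computes the
    value. *)
Lemma LInt_val (a b v : R) (f g : R -> R) : LInt a b f v ->
  lambda.-integrable `[a, b] (EFin \o g) ->
  {ae lambda, forall t, `[a, b]%classic t -> f t = g t} ->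
  v = \int[lambda]_(t in `[a, b]) g t.
Proof.
move=> [g' [ig' [fg' ->]]] ig fg; congr fine; apply: ae_eq_integral => //.
- by case/integrableP : ig'.
- by case/integrableP : ig.
apply: (@filterS2 _ _ (ae_filter_ringOfSetsType lambda)) fg fg' => t ft ft' tab /=.
by rewrite -ft// -ft'.
Qed.

Lemma Rintegral_itv_cat (f : R -> R) (a b c : R) : a <= b -> b <= c ->
  lambda.-integrable `[a, c] (EFin \o f) ->
  \int[lambda]_(t in `[a, c]) f t =
  \int[lambda]_(t in `[a, b]) f t + \int[lambda]_(t in `[b, c]) f t.
Proof.
move=> ab bc intf.
have H := @Rintegral_itvB _ f (BLeft a) (BRight c) b intf _ _.
rewrite -(Rintegral_itv_obnd_cbnd (r := b)); last first.
  by apply: integrableS intf => // x /=; rewrite !in_itv/=; lra.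
by rewrite -H ?bnd_simp// addrC subrK.
Qed.

End Oriented_integrals.

Section Generalized_inverse.
Context {R : realType} (u : R -> R).
Hypothesis incu : {homo u : x y / x < y}.
Hypothesis cu : continuous u.

Let ndu : {homo u : x y / x <= y}.
Proof. by move=> x y; rewrite le_eqVlt => /orP[/eqP->//|/incu/ltW]. Qed.

Lemma le_uinv y z : u y <= z -> (y%:E <= uinv u z)%E.
Proof. by move=> uy; apply: ereal_sup_ubound; exists y. Qed.

(** The supremum in [uinv] may be infinite or not visibly attained. Each [x < y] lies below some
    [x'] with [u x' <= z], and continuity of [u] carries the bound to [y]. *)
Lemma uinv_le y z : (y%:E <= uinv u z)%E -> u y <= z.
Proof.
move=> yz.
have H : \forall x \near y^'-, u x <= z.
  near=> x.
  have xy : x < y by near: x; exact: nbhs_left_lt.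
  have : (x%:E < uinv u z)%E by apply: lt_le_trans yz; rewrite lte_fin.
  move=> /ereal_sup_gt[_ [x' /= ux' <-]]; rewrite lte_fin => xx'.
  by apply: le_trans ux'; exact/ndu/ltW.
have cv : u x @[x --> y^'-] --> u y by apply: cvg_at_left_filter; exact: cu.
rewrite -(cvg_lim _ cv)//; apply: limr_le => //.
by apply/cvg_ex; exists (u y).
Unshelve. all: by end_near. Qed.

Lemma uinvK y : uinv u (u y) = y%:E.
Proof.
apply/eqP; rewrite eq_le le_uinv// andbT; apply: ge_ereal_sup => _ [x /= ux <-].
by rewrite lee_fin leNgt; apply/negP => /incu; rewrite ltNge ux.
Qed.

End Generalized_inverse.

Section Wage_utility.
Context {R : realType} (X : set R) (u w : R -> R).
Hypothesis cX : compact X.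
Hypothesis X0 : X !=set0.
Hypothesis incu : {homo u : x y / x < y}.
Hypothesis cu : continuous u.
Hypothesis mw : measurable_fun X w.
Hypothesis bw : exists M : R, forall x, X x -> w x <= M.
Hypothesis ndw : forall x y, X x -> X y -> x <= y -> w x <= w y.
Hypothesis rcw : forall x, X x -> w @ within [set y | X y /\ x <= y] (nbhs x) --> w x.

Let ndu : {homo u : x y / x <= y}.
Proof. by move=> x y; rewrite le_eqVlt => /orP[/eqP->//|/incu/ltW]. Qed.

Lemma measurable_wage_utility : measurable_fun X (fun x => u (w x)).
Proof. by apply: measurableT_comp => //; exact: continuous_measurable_fun. Qed.

(** Compactness gives [X] a least point [x0], where monotonicity yields the lower bound. *)
Lemma bounded_wage_utility : exists B, forall x, X x -> `|u (w x)| <= B.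
Proof.
have [M wM] := bw.
have cid : {within X, continuous (@idfun R)} by apply: continuous_subspaceT => x; exact: cvg_id.
have [x0 /[!inE] Xx0 x0min] := compact_EVT_min X0 cX cid.
exists (`|u (w x0)| + `|u M|) => x Xx.
have : u (w x0) <= u (w x) by apply/ndu/ndw => //; apply: x0min; rewrite inE.
have : u (w x) <= u M by exact/ndu/wM.
have := ler_norm (u M); have := lerNnormlW (lexx `|u (w x0)|).
have := normr_ge0 (u M); have := normr_ge0 (u (w x0)).
by rewrite ler_norml; lra.
Qed.

(** Points to the right of [x] are handled by right continuity, points to the left by
    monotonicity. *)
Lemma usc_wage_utility : usc_on X (fun x => u (w x)).
Proof.
move=> x Xx e e0.
have /cvgrPdist_lt/(_ e e0)/nbhs_ballP[d /= d0 Hd] := @cu (w x).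
have /cvgrPdist_lt/(_ d d0) := rcw Xx.
rewrite near_withinE => /nbhs_ballP[d' /= d'0 Hd'].
exists d' => // y Xy yx; have [xy|yx'] := leP x y.
  have := Hd' y; rewrite /ball/= distrC => /(_ yx (conj Xy xy)) wxy.
  have := Hd (w y) wxy; rewrite ltr_norml; lra.
by have := ndu (ndw Xy Xx (ltW yx')); lra.
Qed.

End Wage_utility.

Section Maximizers.
Context {R : realType} (X : set R) (h : R -> R) (C : probability R R -> R) (M : R).
Hypothesis cX : compact X.
Hypothesis X0 : exists m, inDelta X m.
Hypothesis CM : forall m, inDelta X m -> `|C m| <= M.
Hypothesis wC : forall (mn : nat -> probability R R) m,
  (forall n, inDelta X (mn n)) -> inDelta X m -> weak_cvg X mn m ->
  (fun n => C (mn n)) @ \oo --> C m.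
Hypothesis mh : measurable_fun X h.
Hypothesis bh : exists B, forall x, X x -> `|h x| <= B.
Hypothesis uh : usc_on X h.

(** The direct method: along a weak*-convergent subsequence of a maximizing sequence, [C] converges
    and the integral of [h] is upper semicontinuous. *)
Lemma maximizer_exists : exists2 m, inDelta X m &
  forall m', inDelta X m' -> \int[m']_(x in X) h x - C m' <= \int[m]_(x in X) h x - C m.
Proof.
have mX : measurable X by exact: compact_measurable.
have [B hB] := bh.
pose J (m : probability R R) := \int[m]_(x in X) h x - C m.
pose S := [set J m | m in [set m | inDelta X m]].
have S0 : S !=set0 by have [m0 m0X] := X0; exists (J m0); exists m0.
have supS : has_sup S.
  split => //; exists (B + M) => _ [m mD <-]; rewrite /J.
  have : \int[m]_(x in X) h x <= B.
    rewrite -[leRHS](Rintegral_const_inDelta mX _ mD); apply: le_Rintegral => //.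
    - exact: bounded_integrable hB.
    - by apply: (@bounded_integrable _ _ _ _ _ _ `|B|).
    - by move=> x /hB; rewrite ler_norml => /andP[].
  by have := CM mD; rewrite ler_norml; lra.
have H n : exists m, inDelta X m /\ sup S - n.+1%:R^-1 < J m.
  have [|_ [m mD <-] Jm] := @sup_adherent _ S n.+1%:R^-1 _ supS; first by rewrite invr_gt0.
  by exists m.
have [m_ /all_and2[m_D m_J]] := choice H.
have [sigma [m [sge mD wm usc]]] := Delta_seq_compact cX m_D.
exists m => // m' m'D; apply: (@le_trans _ _ (sup S)).
  by apply: sup_upper_bound => //; exists m'.
rewrite lerBrDr.
(* Near-optimality bounds the integrals of [h] below by this sequence, which tends to
   [sup S + C m]. *)
apply: (usc h B (fun n => sup S - n.+1%:R^-1 + C (m_ (sigma n)))) => //.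
  move=> n; have := m_J (sigma n); rewrite /J/= => Jn.
  have : (sigma n).+1%:R^-1 <= n.+1%:R^-1 :> R.
    by rewrite lef_pV2 ?posrE// ler_nat ltnS sge.
  by move: Jn; move: ((sigma n).+1%:R^-1 : R) (n.+1%:R^-1 : R) => x y; lra.
apply: cvgD; last by apply: wC wm => // n; exact: m_D.
rewrite -[X in _ --> X]subr0; apply: cvgB; first exact: cvg_cst.
exact: cvg_harmonic.
Qed.

End Maximizers.

(** * Incentive compatibility against the envelope, monotonicity and obedience conditions *)

Section Mechanism.
Context {R : realType}.
Notation lambda := (@lebesgue_measure R).
Variables (X : set R) (thl thh : R) (u : R -> R).
Variables (C : R -> probability R R -> R) (c : R -> probability R R -> R -> R).
Variables (dC : R -> probability R R -> R) (w : R -> R -> R) (mu : R -> probability R R).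
Variable M : R.
Hypothesis cX : compact X.
Hypothesis lh : thl < thh.
Hypothesis incu : {homo u : x y / x < y}.
Hypothesis cu : continuous u.
Hypothesis Cpeq : forall th m1 m2, thl <= th <= thh -> inDelta X m1 -> inDelta X m2 ->
  peq m1 m2 -> C th m1 = C th m2.
Hypothesis CM : forall th m, thl <= th <= thh -> inDelta X m -> `|C th m| <= M.
Hypothesis wC : forall th, thl <= th <= thh -> forall (mn : nat -> probability R R) m,
  (forall n, inDelta X (mn n)) -> inDelta X m -> weak_cvg X mn m ->
  (fun n => C th (mn n)) @ \oo --> C th m.
Hypothesis cvxC : forall th m1 m2 nu l, thl <= th <= thh ->
  inDelta X m1 -> inDelta X m2 -> inDelta X nu -> 0 <= l <= 1 ->
  is_mixture nu m1 m2 l -> C th nu <= (1 - l) * C th m1 + l * C th m2.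
Hypothesis dirC : forall th m, thl <= th <= thh -> inDelta X m ->
  {within X, continuous (c th m)} /\
  forall (m' : probability R R) (mix : R -> probability R R), inDelta X m' ->
    (forall e, 0 < e <= 1 -> is_mixture (mix e) m m' e) ->
    (fun e => (C th (mix e) - C th m) / e) @ (0:R)^'+ -->
      (\int[m']_(x in X) c th m x - \int[m]_(x in X) c th m x).
Hypothesis decC : forall m, inDelta X m -> forall s t, thl <= s -> s < t -> t <= thh -> C t m < C s m.
Hypothesis derC : forall m, inDelta X m -> C1_on thl thh (fun t => C t m) (fun t => dC t m).
Hypothesis wP : forall th, thl <= th <= thh ->
  [/\ measurable_fun X (w th),
      (exists M : R, forall x, X x -> w th x <= M),
      (forall x y, X x -> X y -> x <= y -> w th x <= w th y) &
      (forall x, X x -> w th @ within [set y | X y /\ x <= y] (nbhs x) --> w th x)].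
Hypothesis muX : forall th, thl <= th <= thh -> inDelta X (mu th).

Let mX : measurable X. Proof. exact: compact_measurable. Qed.

Let X0 : X !=set0.
Proof.
apply/set0P; apply/eqP => XE.
have : inDelta X (mu thl) by apply: muX; rewrite lexx ltW.
by rewrite /inDelta XE measure0 => /eqP; rewrite eq_sym onee_eq0.
Qed.

Let h th x := u (w th x).

Let mh th : thl <= th <= thh -> measurable_fun X (h th).
Proof. by move=> /wP[mw _ _ _]; exact: measurable_wage_utility cu mw. Qed.

Let bh th : thl <= th <= thh -> exists B, forall x, X x -> `|h th x| <= B.
Proof. by move=> /wP[_ bw ndw _]; exact: (bounded_wage_utility cX X0 incu bw ndw). Qed.

Let uh th : thl <= th <= thh -> usc_on X (h th).
Proof. by move=> /wP[_ _ ndw rcw]; exact: (usc_wage_utility incu cu ndw rcw). Qed.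

Let mc th m : thl <= th <= thh -> inDelta X m -> measurable_fun X (c th m).
Proof.
by move=> thI mD; apply: subspace_continuous_measurable_fun => //; exact: (dirC thI mD).1.
Qed.

Let bc th m : thl <= th <= thh -> inDelta X m -> exists B, forall x, X x -> `|c th m x| <= B.
Proof. by move=> thI mD; apply: within_continuous_bounded => //; exact: (dirC thI mD).1. Qed.

Let inth th (S : probability R R) : thl <= th <= thh -> S.-integrable X (EFin \o h th).
Proof. by move=> thI; have [B hB] := bh thI; apply: bounded_integrable hB => //; exact: mh. Qed.

Let intc th m (S : probability R R) : thl <= th <= thh -> inDelta X m ->
  S.-integrable X (EFin \o c th m).
Proof. by move=> thI mD; have [B cB] := bc thI mD; apply: bounded_integrable cB => //; exact: mc. Qed.

Let maximizes th th' m := forall m', inDelta X m' ->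
  Upay X u C th (w th') m' <= Upay X u C th (w th') m.

Let foc th th' m := forall nu : probability R R, inDelta X nu ->
  \int[nu]_(x in X) (u (w th' x) - c th m x) <= \int[m]_(x in X) (u (w th' x) - c th m x).

Let maximizesP th th' m : thl <= th <= thh -> thl <= th' <= thh -> inDelta X m ->
  maximizes th th' m <-> foc th th' m.
Proof.
move=> thI thI' mD; split.
- apply: (@maximizer_foc _ X mX (C th) (c th m) (h th') m mD) => //.
  + exact: mc.
  + exact: bc.
  + exact: mh.
  + exact: bh.
  + exact: (dirC thI mD).2.
- apply: (@foc_maximizer _ X mX (C th) (c th m) (h th') m mD) => //.
  + by move=> m1 m2 nu l; exact: cvxC.
  + exact: mc.
  + exact: bc.
  + exact: mh.
  + exact: bh.
  + exact: (dirC thI mD).2.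
Qed.

Let IC := forall th th' (m' : probability R R), thl <= th <= thh -> thl <= th' <= thh ->
  inDelta X m' -> Upay X u C th (w th') m' <= Upay X u C th (w th) (mu th).

Let V th := Upay X u C th (w th) (mu th).

(** Identifies the constant of on-path obedience as a mean: the condition says that
    [u (w th x) - c th (mu th) x] nowhere exceeds its average under [mu th]. *)
Let on_path_level th : thl <= th <= thh ->
  V th + C th (mu th) - \int[mu th]_(y in X) c th (mu th) y =
  \int[mu th]_(x in X) (u (w th x) - c th (mu th) x).
Proof.
move=> thI; have muD := muX thI.
rewrite (RintegralB mX (inth (mu th) thI) (intc (mu th) thI muD)) /V /Upay /h; lra.
Qed.

(** Best responses exist for every report; on the diagonal [IC] permits the choice of [mu th]
    itself. *)
Lemma IC_schedule : IC -> exists mm : R -> R -> probability R R,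
  [/\ forall th th', thl <= th <= thh -> thl <= th' <= thh -> inDelta X (mm th th'),
      forall th, mm th th = mu th &
      forall th th', thl <= th <= thh -> thl <= th' <= thh -> maximizes th th' (mm th th')].
Proof.
move=> ic.
have H (p : R * R) : exists m, thl <= p.1 <= thh -> thl <= p.2 <= thh ->
    inDelta X m /\ maximizes p.1 p.2 m.
  have [pI|npI] := pselect (thl <= p.1 <= thh /\ thl <= p.2 <= thh); last first.
    by exists (mu thl) => p1 p2; case: npI.
  have [p1 p2] := pI.
  have [m mD mmax] := @maximizer_exists _ X (h p.2) (C p.1) M cX
    (ex_intro _ _ (muX p1)) (fun m => CM p1) (wC p1) (mh p2) (bh p2) (uh p2).
  by exists m.
have [f Hf] := choice H.
exists (fun th th' => if th' == th then mu th else f (th, th')); split.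
- move=> th th' thI thI'; case: ifPn => _; first exact: muX.
  exact: (Hf (th, th') thI thI').1.
- by move=> th; rewrite eqxx.
- move=> th th' thI thI'; case: ifPn => [/eqP->|_]; first by move=> m'; exact: ic.
  exact: (Hf (th, th') thI thI').2.
Qed.

(** With the report [th'] fixed, all types face the same wage, so the measure of any other type is a
    feasible deviation. *)
Lemma schedule_envelope (mm : R -> R -> probability R R) :
  (forall th th', thl <= th <= thh -> thl <= th' <= thh -> inDelta X (mm th th')) ->
  (forall th th', thl <= th <= thh -> thl <= th' <= thh -> maximizes th th' (mm th th')) ->
  forall th', thl <= th' <= thh -> exists g : R -> R,
  [/\ lambda.-integrable setT (EFin \o g),
     forall s t, thl <= s -> s <= t -> t <= thh ->
       Upay X u C t (w th') (mm t th') - Upay X u C s (w th') (mm s th') =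
       \int[lambda]_(x in `[s, t]) g x &
     {ae lambda, forall t : R, thl <= t <= thh -> dC t (mm t th') = - g t}].
Proof.
move=> mmD mmax th' thI'.
apply: (@envelope _ X thl thh M C dC cX lh CM wC decC derC
  (fun t => \int[mm t th']_(x in X) u (w th' x)) (fun t => mm t th')).
- by move=> t tI; exact: mmD.
- by move=> s t sI tI; apply: (mmax t th' tI thI'); exact: mmD.
Qed.

(** Here type [t] imitates [s] by both reporting [s] and choosing [mu s], a double deviation that
    [IC] makes unprofitable. *)
Lemma IC_envelope : IC -> exists g : R -> R,
  [/\ lambda.-integrable setT (EFin \o g),
     forall s t, thl <= s -> s <= t -> t <= thh -> V t - V s = \int[lambda]_(x in `[s, t]) g x &
     {ae lambda, forall t : R, thl <= t <= thh -> dC t (mu t) = - g t}].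
Proof.
move=> ic.
apply: (@envelope _ X thl thh M C dC cX lh CM wC decC derC
  (fun t => \int[mu t]_(x in X) u (w t x)) mu) => //.
by move=> s t sI tI; apply: ic => //; exact: muX.
Qed.

(** This is the first-order condition tested on the Dirac measure at [x]. *)
Let on_path_le th : thl <= th <= thh -> foc th th (mu th) -> forall x, X x ->
  u (w th x) <= c th (mu th) x + V th + C th (mu th) - \int[mu th]_(y in X) c th (mu th) y.
Proof.
move=> thI fo x Xx; have muD := muX thI.
have dD : inDelta X (dirac x : probability R R) by rewrite /inDelta/= diracE mem_set.
have := fo _ dD; rewrite -(on_path_level thI).
have -> : \int[(dirac x : probability R R)]_(x0 in X) (u (w th x0) - c th (mu th) x0) =
    u (w th x) - c th (mu th) x.
  have mE : measurable_fun X (EFin \o (fun y => u (w th y) - c th (mu th) y)).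
    by apply/measurable_EFinP; apply: measurable_funB; [exact: mh|exact: mc].
  by rewrite /Rintegral/= (integral_dirac x mX mE) diracE mem_set// mul1e.
by lra.
Qed.

Lemma IC_conditions : IC ->
  exists mm : R -> R -> probability R R,
    (forall th th', thl <= th <= thh -> thl <= th' <= thh -> inDelta X (mm th th')) /\
    (forall th, thl <= th <= thh -> peq (mm th th) (mu th)) /\
    exists V : R -> R,
      abs_cont_on thl thh V /\
      (forall th, thl <= th <= thh -> V th = Upay X u C th (w th) (mu th)) /\
      forall th, thl <= th <= thh ->
        [/\ (exists v, LInt thl th (fun t => dC t (mu t)) v /\ V th = V thl - v),
            (forall th', thl <= th' <= thh ->
               exists v, OInt th' th (fun t => - dC t (mu t) + dC t (mm t th')) v /\ 0 <= v),
            (forall x, X x ->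
               ((w th x)%:E <= uinv u (c th (mu th) x + V th + C th (mu th)
                                       - \int[mu th]_(y in X) c th (mu th) y))%E),
            {ae mu th, forall x, X x ->
               (w th x)%:E = uinv u (c th (mu th) x + V th + C th (mu th)
                                     - \int[mu th]_(y in X) c th (mu th) y)} &
            (forall th', thl <= th' <= thh -> th' != th ->
               forall nu : probability R R, inDelta X nu ->
                 \int[nu]_(x in X) (u (w th' x) - c th (mm th th') x)
                 <= \int[mm th th']_(x in X) (u (w th' x) - c th (mm th th') x))].
Proof.
move=> ic; have [mm [mmD mmmu mmax]] := IC_schedule ic.
exists mm; split => //; split; first by move=> th _; rewrite mmmu.
have [g [ig Vg aeg]] := IC_envelope ic.
exists V; split; first exact: integral_abs_cont ig Vg.
split=> // th thI; have /andP[lth thh'] := thI.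
have muD := muX thI.
have fo : foc th th (mu th) by apply/maximizesP => //; rewrite -{1}(mmmu th); exact: mmax.
have opl := on_path_le thI fo.
split.
- exists (V thl - V th); split; last by lra.
  exists (fun t => - g t); split; last split.
  + have -> : EFin \o (fun t => - g t) = (fun t => - (EFin \o g) t)%E by [].
    by apply: integrableN; exact: integrableS ig.
  + apply: (@filterS _ _ (ae_filter_ringOfSetsType lambda)) aeg => t tg.
    by rewrite /= in_itv/= => /andP[lt tth]; apply: tg; rewrite lt (le_trans tth).
  + have igI : lambda.-integrable `[thl, th] (EFin \o g) by exact: integrableS ig.
    have -> : \int[lambda]_(t in `[thl, th]) (- g t) = - \int[lambda]_(t in `[thl, th]) g t.
      rewrite -mulN1r -RintegralZl//; apply: eq_Rintegral => x _; by rewrite mulN1r.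
    by rewrite -opprB; congr (- _); exact: Vg.
- move=> th' thI'; have /andP[lth' thh''] := thI'.
  have [g2 [ig2 Wg ae2]] := schedule_envelope mmD mmax thI'.
  (* The value of reporting [th'] and responding optimally; the two envelope formulas make the
     monotonicity integral the increment of [V - W]. *)
  pose W t := Upay X u C t (w th') (mm t th').
  have LI s t : thl <= s -> s <= t -> t <= thh ->
      LInt s t (fun t => - dC t (mu t) + dC t (mm t th')) ((V t - V s) - (W t - W s)).
    move=> ls st tth; exists (fun t => g t - g2 t); split; last split.
    + have -> : EFin \o (fun t => g t - g2 t) = ((EFin \o g) \- (EFin \o g2))%E by [].
      by apply: integrableB => //; [exact: integrableS ig|exact: integrableS ig2].
    + apply: (@filterS2 _ _ (ae_filter_ringOfSetsType lambda)) aeg ae2 => x x1 x2.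
      rewrite /= in_itv/= => /andP[sx xt].
      have xI : thl <= x <= thh by rewrite (le_trans ls sx) (le_trans xt tth).
      by rewrite x1// x2// opprK.
    + by rewrite RintegralB// ?Vg ?Wg//; [exact: integrableS ig|exact: integrableS ig2].
  have WV : W th' = V th' by rewrite /W mmmu.
  have WleV : W th <= V th by apply: ic => //; exact: mmD.
  exists ((V th - V th') - (W th - W th')); split; last by rewrite WV; lra.
  rewrite /OInt; case: ifPn => [|]; first by move=> tt; exact: LI.
  rewrite -ltNge => /ltW tt.
  have -> : - (V th - V th' - (W th - W th')) = V th' - V th - (W th' - W th) by lra.
  exact: LI.
- by move=> x Xx; apply: le_uinv; exact: opl.
(* The gap [f] between the mean [k] and the function averaged is nonnegative with integral 0, so it
   vanishes almost everywhere. *)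
- pose k := \int[mu th]_(x in X) (u (w th x) - c th (mu th) x).
  pose f x := k - (u (w th x) - c th (mu th) x).
  have mhc : measurable_fun X (fun x => u (w th x) - c th (mu th) x).
    by apply: measurable_funB; [exact: mh|exact: mc].
  have mf : measurable_fun X f by exact: measurable_funB.
  have f0 x : X x -> 0 <= f x.
    by move=> /opl; have := on_path_level thI; rewrite -/k /f; lra.
  have ihc : (mu th).-integrable X (EFin \o (fun x => u (w th x) - c th (mu th) x)).
    have -> : EFin \o (fun x => u (w th x) - c th (mu th) x) =
      ((EFin \o h th) \- (EFin \o c th (mu th)))%E by [].
    by apply: integrableB => //; [exact: inth|exact: intc].
  have ik : (mu th).-integrable X (EFin \o (fun=> k)).
    by apply: (@bounded_integrable _ _ _ _ _ _ `|k|).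
  have If : \int[mu th]_(x in X) f x = 0.
    by rewrite (RintegralB mX ik ihc) (Rintegral_const_inDelta mX _ muD) subrr.
  have Ifin : (\int[mu th]_(x in X) (f x)%:E)%E \is a fin_num.
    apply: integrable_fin_num => //.
    have -> : (fun x => (f x)%:E) = ((EFin \o (fun=> k)) \-
      (EFin \o (fun x => u (w th x) - c th (mu th) x)%R))%E by [].
    exact: integrableB.
  have : (\int[mu th]_(x in X) `|(EFin \o f) x| = 0)%E.
    rewrite -[RHS]/((0 : R)%:E) -If /Rintegral fineK//; apply: eq_integral => x /[!inE] Xx.
    by rewrite /= ger0_norm// f0.
  have mEf : measurable_fun X (EFin \o f) by exact/measurable_EFinP.
  move=> /(ae_eq_integral_abs (mu th) mX mEf).1 aef.
  apply: (@filterS _ _ (ae_filter_ringOfSetsType (mu th))) aef => x fx Xx.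
  have {}fx : f x = 0 by have [] := fx Xx.
  rewrite -[LHS](uinvK incu); congr uinv.
  by move: fx; have := on_path_level thI; rewrite -/k /f; lra.
- by move=> th' thI' _; apply/maximizesP => //; [exact: mmD|exact: mmax].
Qed.

(** On-path obedience integrates to the first-order condition for [mu th], and by convexity both
    obedience conditions yield maximizers. With [W] the value of reporting [th'], generalized
    monotonicity reads [V th - V th' >= W th - W th']; as [W th' = V th'], this gives
    [W th <= V th]. *)
Lemma conditions_IC (mm : R -> R -> probability R R) :
  (forall th th', thl <= th <= thh -> thl <= th' <= thh -> inDelta X (mm th th')) ->
  (forall th, thl <= th <= thh -> peq (mm th th) (mu th)) ->
  (forall th, thl <= th <= thh ->
    [/\ (exists v, LInt thl th (fun t => dC t (mu t)) v /\ V th = V thl - v),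
        (forall th', thl <= th' <= thh ->
           exists v, OInt th' th (fun t => - dC t (mu t) + dC t (mm t th')) v /\ 0 <= v),
        (forall x, X x ->
           ((w th x)%:E <= uinv u (c th (mu th) x + V th + C th (mu th)
                                   - \int[mu th]_(y in X) c th (mu th) y))%E) &
        (forall th', thl <= th' <= thh -> th' != th -> foc th th' (mm th th'))]) ->
  IC.
Proof.
move=> mmD mmmu H.
have mumax th : thl <= th <= thh -> maximizes th th (mu th).
  move=> thI; apply/maximizesP => //; first exact: muX.
  move=> nu nuX; have [_ _ H3 _] := H th thI; have muD := muX thI.
  rewrite -(on_path_level thI).
  rewrite -[leRHS](Rintegral_const_inDelta mX _ nuX); apply: le_Rintegral => //.
  - have -> : EFin \o (fun x => u (w th x) - c th (mu th) x) =
      ((EFin \o h th) \- (EFin \o c th (mu th)))%E by [].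
    by apply: integrableB => //; [exact: inth|exact: intc].
  - by apply: (@bounded_integrable _ _ _ _ _ _
      `|V th + C th (mu th) - \int[mu th]_(y in X) c th (mu th) y|).
  - by move=> x Xx; have := uinv_le incu cu (H3 x Xx); lra.
(* [mm th th] and [mu th] agree only as set functions on measurable sets, so their costs are
   compared through [Cpeq]. *)
have Umm th : thl <= th <= thh -> Upay X u C th (w th) (mm th th) = V th.
  move=> thI; rewrite /Upay /V /Upay (eq_Rintegral_peq _ _ (mmmu th thI)).
  by rewrite (Cpeq thI (mmD _ _ thI thI) (muX thI) (mmmu th thI)).
have mmmax th th' : thl <= th <= thh -> thl <= th' <= thh -> maximizes th th' (mm th th').
  move=> thI thI'; have [->|tt] := eqVneq th' th.
    by move=> m' m'D; rewrite (Umm th thI); exact: mumax.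
  have [_ _ _ H4] := H th thI; apply/maximizesP => //; first exact: mmD.
  exact: H4.
have hI : thl <= thh <= thh by rewrite lexx ltW.
(* The representative obtained on all of [[thl, thh]] serves every subinterval, by [LInt_val]. *)
have [[v1 [[g1 [ig1 [aeg1 _]]] _]] _ _ _] := H thh hI.
have ig1S a b : thl <= a -> b <= thh -> lambda.-integrable `[a, b] (EFin \o g1).
  move=> la bh'; apply: integrableS ig1 => // x /=; rewrite !in_itv/= => /andP[ax xb].
  by rewrite (le_trans la ax) (le_trans xb bh').
have Vg1 th : thl <= th <= thh -> V th = V thl - \int[lambda]_(t in `[thl, th]) g1 t.
  move=> thI; have [[v [Lv ->]] _ _ _] := H th thI; have /andP[lt th'] := thI.
  congr (_ - _); apply: (LInt_val Lv); first exact: ig1S.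
  apply: (@filterS _ _ (ae_filter_ringOfSetsType lambda)) aeg1 => t tg.
  by rewrite /= in_itv/= => /andP[lt' tth]; apply: tg; rewrite /= in_itv/= lt' (le_trans tth).
have Vst s t : thl <= s -> s <= t -> t <= thh ->
    V t - V s = - \int[lambda]_(x in `[s, t]) g1 x.
  move=> ls st tth.
  have -> : V t = V thl - \int[lambda]_(x in `[thl, t]) g1 x.
    by apply: Vg1; rewrite tth (le_trans ls).
  have -> : V s = V thl - \int[lambda]_(x in `[thl, s]) g1 x.
    by apply: Vg1; rewrite ls (le_trans st).
  by rewrite (Rintegral_itv_cat ls st (ig1S _ _ (lexx _) tth)); lra.
move=> th th' m' thI thI' m'D.
apply: le_trans (mmmax th th' thI thI' m' m'D) _.
have [g2 [ig2 Wg ae2]] := schedule_envelope mmD mmmax thI'.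
pose W t := Upay X u C t (w th') (mm t th').
have LI s t v : thl <= s -> s <= t -> t <= thh ->
    LInt s t (fun t => - dC t (mu t) + dC t (mm t th')) v -> v = (V t - V s) - (W t - W s).
  move=> ls st tth Lv.
  have ig2S : lambda.-integrable `[s, t] (EFin \o g2) by exact: integrableS ig2.
  have ig1st := ig1S s t ls tth.
  have -> : v = \int[lambda]_(x in `[s, t]) (- 1 * g1 x - g2 x).
    apply: (LInt_val Lv).
      have -> : EFin \o (fun x => - 1 * g1 x - g2 x) =
        ((fun x => (- 1)%:E * (EFin \o g1) x) \- (EFin \o g2))%E by [].
      by apply: integrableB => //; exact: integrableZl.
    apply: (@filterS2 _ _ (ae_filter_ringOfSetsType lambda)) aeg1 ae2 => x x1 x2.
    rewrite /= in_itv/= => /andP[sx xt].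
    have xI : thl <= x <= thh by rewrite (le_trans ls sx) (le_trans xt tth).
    by rewrite x1; [rewrite x2// mulN1r|rewrite /= in_itv].
  have iZ : lambda.-integrable `[s, t] (EFin \o (fun x => - 1 * g1 x)).
    have -> : EFin \o (fun x => - 1 * g1 x) = (fun x => (- 1)%:E * (EFin \o g1) x)%E by [].
    exact: integrableZl.
  rewrite RintegralB//.
  by rewrite RintegralZl// Vst// Wg// mulN1r.
have WV : W th' = V th' by exact: Umm.
have [_ /(_ th' thI')[v [Ov v0]] _ _] := H th thI.
have /andP[lt tth] := thI; have /andP[lt' tth'] := thI'.
rewrite -/(W th) -/(V th); move: Ov; rewrite /OInt; case: ifPn => [tt Ov|].
  by have := LI _ _ _ lt' tt tth Ov; rewrite WV; lra.
by rewrite -ltNge => /ltW tt Ov; have := LI _ _ _ lt tt tth' Ov; rewrite WV; lra.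
Qed.

End Mechanism.

Theorem theorem1 (R : realType) (X : set R) (thl thh : R) (u : R -> R)
  (C : R -> probability R R -> R) (c : R -> probability R R -> R -> R)
  (dC : R -> probability R R -> R)
  (w : R -> R -> R) (mu : R -> probability R R) :
  (* the outcome space X: finite, or a compact interval *)
  (finite_set X \/ exists xl xh : R, X = `[xl, xh]%classic) ->
  (* Theta = [thl, thh] *)
  thl < thh ->
  (* u strictly increasing, continuous, weakly concave *)
  {homo u : x y / x < y} -> continuous u ->
  (forall x y l : R, 0 <= l <= 1 -> (1 - l) * u x + l * u y <= u ((1 - l) * x + l * y)) ->
  (* C is a function on Theta x Delta(X) (depends only on the measure) *)
  (forall th m1 m2, thl <= th <= thh -> inDelta X m1 -> inDelta X m2 ->
     peq m1 m2 -> C th m1 = C th m2) ->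
  (* C bounded *)
  (exists M : R, forall th m, thl <= th <= thh -> inDelta X m -> `|C th m| <= M) ->
  (* C(th, .) weak*-continuous *)
  (forall th, thl <= th <= thh -> forall (mn : nat -> probability R R) m,
     (forall n, inDelta X (mn n)) -> inDelta X m -> weak_cvg X mn m ->
     (fun n => C th (mn n)) @ \oo --> C th m) ->
  (* C(th, .) convex *)
  (forall th m1 m2 nu l, thl <= th <= thh ->
     inDelta X m1 -> inDelta X m2 -> inDelta X nu -> 0 <= l <= 1 ->
     is_mixture nu m1 m2 l -> C th nu <= (1 - l) * C th m1 + l * C th m2) ->
  (* (i) monotone w.r.t. first-order stochastic dominance *)
  (forall th m m', thl <= th <= thh -> inDelta X m -> inDelta X m' ->
     fosd m' m -> C th m <= C th m') ->
  (* (ii) directional derivatives represented by a continuous kernel c_m(th, .) *)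
  (forall th m, thl <= th <= thh -> inDelta X m ->
     {within X, continuous (c th m)} /\
     forall (m' : probability R R) (mix : R -> probability R R), inDelta X m' ->
       (forall e, 0 < e <= 1 -> is_mixture (mix e) m m' e) ->
       (fun e => (C th (mix e) - C th m) / e) @ (0:R)^'+ -->
         (\int[m']_(x in X) c th m x - \int[m]_(x in X) c th m x)) ->
  (* (iii) C(., m) strictly decreasing and C^1 with derivative dC(., m) *)
  (forall m, inDelta X m -> forall s t, thl <= s -> s < t -> t <= thh -> C t m < C s m) ->
  (forall m, inDelta X m -> C1_on thl thh (fun t => C t m) (fun t => dC t m)) ->
  (forall th, thl <= th <= thh ->
     exists M : R, forall m, inDelta X m -> `|dC th m| <= M) ->
  (* the mechanism {w_th, mu_th} *)
  (forall th, thl <= th <= thh ->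
     [/\ measurable_fun X (w th),
         (exists M : R, forall x, X x -> w th x <= M),
         (forall x y, X x -> X y -> x <= y -> w th x <= w th y) &
         (forall x, X x -> w th @ within [set y | X y /\ x <= y] (nbhs x) --> w th x)]) ->
  (forall th, thl <= th <= thh -> inDelta X (mu th)) ->
  (* incentive compatibility *)
  (forall th th' (m' : probability R R), thl <= th <= thh -> thl <= th' <= thh ->
     inDelta X m' -> Upay X u C th (w th') m' <= Upay X u C th (w th) (mu th))
  <->
  (exists mm : R -> R -> probability R R,
    (forall th th', thl <= th <= thh -> thl <= th' <= thh -> inDelta X (mm th th')) /\
    (forall th, thl <= th <= thh -> peq (mm th th) (mu th)) /\
    exists V : R -> R,
      abs_cont_on thl thh V /\
      (forall th, thl <= th <= thh -> V th = Upay X u C th (w th) (mu th)) /\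
      forall th, thl <= th <= thh ->
        [/\ (* 1. envelope *)
            (exists v, LInt thl th (fun t => dC t (mu t)) v /\ V th = V thl - v),
            (* 2. generalized monotonicity *)
            (forall th', thl <= th' <= thh ->
               exists v, OInt th' th (fun t => - dC t (mu t) + dC t (mm t th')) v /\ 0 <= v),
            (* 3. on-path obedience *)
            (forall x, X x ->
               ((w th x)%:E <= uinv u (c th (mu th) x + V th + C th (mu th)
                                       - \int[mu th]_(y in X) c th (mu th) y))%E),
            {ae mu th, forall x, X x ->
               (w th x)%:E = uinv u (c th (mu th) x + V th + C th (mu th)
                                     - \int[mu th]_(y in X) c th (mu th) y)} &
            (* 4. off-path obedience *)
            (forall th', thl <= th' <= thh -> th' != th ->
               forall nu : probability R R, inDelta X nu ->
                 \int[nu]_(x in X) (u (w th' x) - c th (mm th th') x)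
                 <= \int[mm th th']_(x in X) (u (w th' x) - c th (mm th th') x))]).
Proof.
move=> Xcase lh incu cu _ Cpeq [M CM] wC cvxC _ dirC decC derC _ wP muX.
have cX : compact X.
  by case: Xcase => [/finite_compact//|[xl [xh ->]]]; exact: segment_compact.
split; first exact: (IC_conditions cX lh incu cu CM wC cvxC dirC decC derC wP muX).
move=> [mm [mmD [mmmu [V [_ [VE H]]]]]].
apply: (conditions_IC cX lh incu cu Cpeq CM wC cvxC dirC decC derC wP muX mmD mmmu).
move=> th thI; have [[v [Lv Vv]] H2 H3 _ H4] := H th thI.
have lI : thl <= thl <= thh by rewrite lexx ltW.
(* The given [V] is replaced by the on-path payoff, with which it agrees on [[thl, thh]]. *)
rewrite (VE th thI) in Vv H3; rewrite (VE thl lI) in Vv.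
by split => //; exists v.
Qed.
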